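(* Let $X$ be a separable symmetric sequence space and let $1\le p\le\infty$. The following conditions are equivalent: (a) $\ell^p$ is symmetrically block finitely represented in the unit vector basis $\{e_k\}_{k=1}^\infty$ of $X$; (b) $\ell^p$ is symmetrically finitely represented in $X$; (c) $\ell^p$ is crudely symmetrically finitely represented in $X$; (d) $2^{1/p}$ (with $2^{1/\infty}:=1$) is an approximate eigenvalue of the operator $D:X\to X$.
   Context: A Banach sequence lattice is a Banach space $E$ of real sequences such that if $x\in E$ and $|y_k|\le|x_k|$ for all $k$, then $y\in E$ and $\|y\|_E\le\|x\|_E$. For a bounded real sequence $u=(u_k)$, $u^*=(u^*_k)$ denotes the nonincreasing rearrangement of $(|u_k|)$, $u^*_k=\inf_{\mathrm{card}A=k-1}\sup_{i\in\mathbb N\setminus A}|u_i|$. A symmetric sequence space is a Banach sequence lattice $X\subset\ell^\infty$ such that $x\in X$ and $y^*=x^*$ imply $y\in X$ and $\|y\|_X=\|x\|_X$. $e_k$ denotes the $k$-th unit vector. For $x=(x_n)$ let $\sigma_2x=(x_{[(1+n)/2]})_{n\ge1}$ and $\tau_1x=(x_{n-1})_{n\ge1}$ (with $x_0:=0$); $D:=\tau_1\sigma_2$, i.e. $(Dx)_k=x_{[k/2]}$, so $Dx=(0,x_1,x_1,x_2,x_2,\dots)$. A real number $\lambda$ is an approximate eigenvalue of a bounded operator $T$ on $X$ if there are $u_n\in X$ with $\|u_n\|_X=1$ and $\|Tu_n-\lambda u_n\|_X\to0$. For $a\in\mathbb R^n$, $\|a\|_p=(\sum|a_k|^p)^{1/p}$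 if $p<\infty$ and $\|a\|_\infty=\max|a_k|$. Two sequences $x,y$ have the same ordered distribution if there is a permutation $\pi$ of $\mathbb N$ with $y_{\pi(k)}=x_k$ for all $k$. Two finite blocks $u=\sum_{i=1}^m\alpha_ie_{n_i}$, $v=\sum_{i=1}^m\beta_ie_{k_i}$ ($n_1<\dots<n_m$, $k_1<\dots<k_m$) have the same ordered distribution if $\beta_i=\alpha_{\pi(i)}$ for some permutation $\pi$ of $\{1,\dots,m\}$. $\ell^p$ is symmetrically block finitely represented in $\{e_k\}$ if for every $n\in\mathbb N$ and $\varepsilon>0$ there are $0=m_0<m_1<\dots<m_n$ and reals $\alpha_i$ such that the blocks $u_k=\sum_{i=m_{k-1}+1}^{m_k}\alpha_ie_i$, $k=1,\dots,n$, pairwise have the same ordered distribution and $(1+\varepsilon)^{-1}\|a\|_p\le\|\sum_{k=1}^na_ku_k\|_X\le(1+\varepsilon)\|a\|_p$ for all $a\in\mathbb R^n$. $\ell^p$ is symmetrically finitely represented in $X$ if for every $n\in\mathbb N$ and $\varepsilon>0$ there exist pairwise disjointly supported $x_1,\dots,x_n\in X$, pairwise having the same ordered distribution, with $(1+\varepsilon)^{-1}\|a\|_p\le\|\sum_{k=1}^na_kx_k\|_X\le(1+\varepsilon)\|a\|_p$ for all $a\in\mathbb R^n$. $\ell^p$ is crudely symmetrically finitely represented in $X$ if there is $C>0$ such that for every $n$ there exist such $x_1,\dots,x_n$ with $C^{-1}\|a\|_p\le\|\sum a_kx_k\|_X\le C\|a\|_p$ for all $a\in\mathbb R^n$. *)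

(* Defs.v *)
From Stdlib Require Import Reals Lra List Permutation.
From Coquelicot Require Import Coquelicot.
Open Scope R_scope.

(* Sequences are indexed by nat starting at 0: the paper's x_k (k >= 1)
   is our x (k-1). *)
Definition seqR := nat -> R.

Definition seq_add (x y : seqR) : seqR := fun k => x k + y k.
Definition seq_scal (c : R) (x : seqR) : seqR := fun k => c * x k.
Definition seq_sub (x y : seqR) : seqR := fun k => x k - y k.
Definition seq0 : seqR := fun _ => 0.

Fixpoint fsum (n : nat) (f : nat -> R) : R :=
  match n with O => 0 | S m => fsum m f + f m end.

Fixpoint fmaxabs (n : nat) (f : nat -> R) : R :=
  match n with O => 0 | S m => Rmax (fmaxabs m f) (Rabs (f m)) end.

Definition rpow (x y : R) : R := if Req_EM_T x 0 then 0 else Rpower x y.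

Definition lp_norm (p : Rbar) (n : nat) (a : nat -> R) : R :=
  match p with
  | Finite q => rpow (fsum n (fun k => rpow (Rabs (a k)) q)) (1 / q)
  | _ => fmaxabs n a
  end.

Definition two_pow_inv (p : Rbar) : R :=
  match p with Finite q => Rpower 2 (1 / q) | _ => 1 end.

(* Nonincreasing rearrangement (0-indexed): u*_k (paper's u*_{k+1})
   = inf over sets A of cardinality k of sup_{i notin A} |u_i|. *)
Definition sup_outside (u : seqR) (A : list nat) : Rbar :=
  Lub_Rbar (fun s => exists i, ~ In i A /\ s = Rabs (u i)).
Definition rearr (u : seqR) (k : nat) : Rbar :=
  Glb_Rbar (fun r => exists A : list nat,
     NoDup A /\ length A = k /\ sup_outside u A = Finite r).

(* Banach space of real sequences: mem is the underlying set, nrm the norm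
   (only its values on mem are constrained). *)
Definition banach_seq_space (mem : seqR -> Prop) (nrm : seqR -> R) : Prop :=
  mem seq0 /\
  (forall x y, mem x -> mem y -> mem (seq_add x y)) /\
  (forall c x, mem x -> mem (seq_scal c x)) /\
  (forall x, mem x -> 0 <= nrm x) /\
  (forall x, mem x -> nrm x = 0 -> forall k, x k = 0) /\
  (forall c x, mem x -> nrm (seq_scal c x) = Rabs c * nrm x) /\
  (forall x y, mem x -> mem y -> nrm (seq_add x y) <= nrm x + nrm y) /\
  (forall s : nat -> seqR, (forall n, mem (s n)) ->
     (forall eps, 0 < eps -> exists N, forall m n, (N <= m)%nat -> (N <= n)%nat ->
        nrm (seq_sub (s m) (s n)) < eps) ->
     exists x, mem x /\ forall eps, 0 < eps -> exists N, forall n, (N <= n)%nat ->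
        nrm (seq_sub (s n) x) < eps).

Definition banach_seq_lattice (mem : seqR -> Prop) (nrm : seqR -> R) : Prop :=
  banach_seq_space mem nrm /\
  (forall x y, mem x -> (forall k, Rabs (y k) <= Rabs (x k)) -> mem y /\ nrm y <= nrm x).

Definition symmetric_seq_space (mem : seqR -> Prop) (nrm : seqR -> R) : Prop :=
  banach_seq_lattice mem nrm /\
  (forall x, mem x -> exists M, forall k, Rabs (x k) <= M) /\
  (forall x y, mem x -> (forall k, rearr y k = rearr x k) -> mem y /\ nrm y = nrm x).

Definition separable (mem : seqR -> Prop) (nrm : seqR -> R) : Prop :=
  exists d : nat -> seqR, (forall n, mem (d n)) /\
    forall x, mem x -> forall eps, 0 < eps -> exists n, nrm (seq_sub x (d n)) < eps.

(* D = tau_1 sigma_2 : (Dx)_k = x_{[k/2]} (1-indexed, x_0 := 0);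
   0-indexed: (D x) 0 = 0, (D x) j = x ((j+1)/2 - 1) for j >= 1. *)
Definition Dop (x : seqR) : seqR :=
  fun j => match j with O => 0 | S _ => x ((j + 1) / 2 - 1)%nat end.

Definition approx_eigenvalue (mem : seqR -> Prop) (nrm : seqR -> R)
  (T : seqR -> seqR) (lam : R) : Prop :=
  exists u : nat -> seqR, (forall n, mem (u n) /\ nrm (u n) = 1) /\
    forall eps, 0 < eps -> exists N, forall n, (N <= n)%nat ->
      nrm (seq_sub (T (u n)) (seq_scal lam (u n))) < eps.

Definition same_ordered_distr (x y : seqR) : Prop :=
  exists pi pinv : nat -> nat,
    (forall k, pinv (pi k) = k) /\ (forall k, pi (pinv k) = k) /\
    (forall k, y (pi k) = x k).

Definition lin_comb (n : nat) (a : nat -> R) (x : nat -> seqR) : seqR :=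
  fun j => fsum n (fun k => a k * x k j).

Definition lp_estimate (nrm : seqR -> R) (p : Rbar) (C : R) (n : nat)
  (x : nat -> seqR) : Prop :=
  forall a : nat -> R,
    / C * lp_norm p n a <= nrm (lin_comb n a x) /\
    nrm (lin_comb n a x) <= C * lp_norm p n a.

(* Blocks: block k (k < n) = sum_{m k <= i < m (k+1)} alpha_i e_i
   (paper's u_{k+1} = sum_{i = m_k + 1}^{m_{k+1}} alpha_i e_i). *)
Definition block (m : nat -> nat) (alpha : nat -> R) (k : nat) : seqR :=
  fun j => if andb (Nat.leb (m k) j) (Nat.ltb j (m (S k))) then alpha j else 0.

Definition block_coeffs (m : nat -> nat) (alpha : nat -> R) (k : nat) : list R :=
  map alpha (seq (m k) (m (S k) - m k)).

Definition sym_block_fin_rep (mem : seqR -> Prop) (nrm : seqR -> R) (p : Rbar) : Prop :=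
  forall (n : nat) (eps : R), 0 < eps ->
    exists (m : nat -> nat) (alpha : nat -> R),
      m O = O /\ (forall k, (k < n)%nat -> (m k < m (S k))%nat) /\
      (forall k, (k < n)%nat -> mem (block m alpha k)) /\
      (forall k l, (k < n)%nat -> (l < n)%nat ->
         (m (S k) - m k = m (S l) - m l)%nat /\
         Permutation (block_coeffs m alpha k) (block_coeffs m alpha l)) /\
      lp_estimate nrm p (1 + eps) n (block m alpha).

Definition admissible_family (mem : seqR -> Prop) (n : nat) (x : nat -> seqR) : Prop :=
  (forall k, (k < n)%nat -> mem (x k)) /\
  (forall k l j, (k < n)%nat -> (l < n)%nat -> k <> l -> x k j <> 0 -> x l j = 0) /\
  (forall k l, (k < n)%nat -> (l < n)%nat -> same_ordered_distr (x k) (x l)).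

Definition sym_fin_rep (mem : seqR -> Prop) (nrm : seqR -> R) (p : Rbar) : Prop :=
  forall (n : nat) (eps : R), 0 < eps ->
    exists x : nat -> seqR, admissible_family mem n x /\ lp_estimate nrm p (1 + eps) n x.

Definition crude_sym_fin_rep (mem : seqR -> Prop) (nrm : seqR -> R) (p : Rbar) : Prop :=
  exists C, 0 < C /\ forall n : nat,
    exists x : nat -> seqR, admissible_family mem n x /\ lp_estimate nrm p C n x.

(* Main.v *)
(** The four conditions are compared through "copies": for [u] in [X] and a finite
    list [l], [copies u l] is the sum of disjoint copies of [u] weighted by the
    entries of [l]; its norm depends only on [u] and on the multiset of the [|l_i|].

    (c) => (a).  Given copies of some [u] that are C-equivalent to the l^p basis, let
    [v_k = (k+1)^(-1/p)], [k < N], and let [a] have l^p norm 1.  Sorting the products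
    [a_j v_k] gives back [v] up to an index shift bounded by the length of [a], so
    copies of [u] weighted by [a_j v_k] have the same norm as those weighted by [v],
    up to a bounded error, whereas the latter norm tends to infinity with [N].  For
    [p = oo] James's argument on the norms of [n^j] equal copies replaces this.

    (c) => (d).  [Dop] maps the node [P] of the binary tree to its two children.  Copies
    of [u] spread over the generations of that tree, generation [l] weighted by
    [2^(-l/p)] times a slowly varying trapezoid, form an approximate eigenvector.

    (d) => (c).  If [Dop u] is close to [2^(1/p) u], a copy weighted [2^(1/p) c] can be
    traded for two copies weighted [c], hence copies with weights comparable to powers
    of [2^(1/p)] for a number of copies of weight 1, and the norm of [2^r] equal copies
    is close to [2^(r/p)].

    Separability makes the norm order continuous, which allows [u] to be truncated to
    finite support. *)
Require Import Defs.
From Stdlib Require Import Reals List Lra Lia Permutation FinFun Cantor.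
From Stdlib Require Import Classical ClassicalEpsilon FunctionalExtensionality.
From Coquelicot Require Import Coquelicot.
Open Scope R_scope.

(** * Powers, finite sums and norms of lists *)

(** For finite p the vector (k+1)^(-1/p) is dictated by its counting function: about s^(-p) of its
    entries exceed s, and the disjoint union of its multiples by a_j has about (sum |a_j|^p) s^(-p)
    such entries, the same law when a is normalized. The discrepancy sits in entries whose l^p norm
    is bounded independently of N, while the whole vector has divergent norm. Normalizing turns a
    bounded absolute error into a vanishing relative one, however large C is. For p = oo the
    analogous vector is constant and its norm does not diverge.

    Since (c) => (a) repairs any constant, (d) => (c) may be wasteful: rounding weights to powers of
    2^(1/p) costs a fixed factor.

    An abrupt cut after L generations of the tree would leave a relative defect of order L^(-1/p),
    useless for p = oo; ramps of length L give order 1/L for every p.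

    Finite support is what allows copies to be laid side by side in intervals, and all coordinates
    of [u] to be put in one generation of the tree. *)

Lemma rpow_0 y : rpow 0 y = 0.
Proof. unfold rpow; destruct (Req_EM_T 0 0); congruence. Qed.

Lemma rpow_pos_eq x y : 0 < x -> rpow x y = Rpower x y.
Proof. intros H; unfold rpow; destruct (Req_EM_T x 0); [lra | reflexivity]. Qed.

Lemma Rpower_pos x y : 0 < Rpower x y.
Proof. apply exp_pos. Qed.

Lemma rpow_nonneg x y : 0 <= rpow x y.
Proof.
unfold rpow; destruct (Req_EM_T x 0); [lra|]; apply Rlt_le, Rpower_pos.
Qed.

Lemma rpow_le x y q : 0 <= q -> 0 <= x <= y -> rpow x q <= rpow y q.
Proof.
intros Hq [H1 H2]; destruct (Req_dec x 0) as [->|Hx].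
- rewrite rpow_0; apply rpow_nonneg.
- rewrite !rpow_pos_eq by lra; apply Rle_Rpower_l; lra.
Qed.

Lemma rpow_mult x y q : 0 <= x -> 0 <= y -> rpow (x * y) q = rpow x q * rpow y q.
Proof.
intros Hx Hy.
destruct (Req_dec x 0) as [->|Hx0]; [rewrite Rmult_0_l, rpow_0; ring|].
destruct (Req_dec y 0) as [->|Hy0]; [rewrite Rmult_0_r, rpow_0; ring|].
rewrite !rpow_pos_eq, Rpower_mult_distr by (try apply Rmult_lt_0_compat; lra).
reflexivity.
Qed.

Lemma rpow_rpow x q r : 0 <= x -> q * r = 1 -> rpow (rpow x q) r = x.
Proof.
intros Hx Hqr; destruct (Req_dec x 0) as [->|Hx0]; [rewrite !rpow_0; reflexivity|].
rewrite (rpow_pos_eq x), rpow_pos_eq by (try apply Rpower_pos; lra).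
rewrite Rpower_mult, Hqr, Rpower_1; lra.
Qed.

Lemma rpow_1_l y : rpow 1 y = 1.
Proof.
rewrite rpow_pos_eq by lra; unfold Rpower; rewrite ln_1, Rmult_0_r; apply exp_0.
Qed.

Lemma rpow_root_le x q : 1 <= q -> 1 <= x -> rpow x (1 / q) <= x.
Proof.
intros Hq Hx; rewrite rpow_pos_eq by lra.
rewrite <- (Rpower_1 x) at 2 by lra.
apply Rle_Rpower; [exact Hx|].
apply Rmult_le_reg_r with q; [lra|]; field_simplify; lra.
Qed.

Definition powsum (q : R) (l : list R) : R :=
  fold_right (fun x s => rpow (Rabs x) q + s) 0 l.

Definition maxabs (l : list R) : R := fold_right (fun x s => Rmax (Rabs x) s) 0 l.

Definition lp_list (p : Rbar) (l : list R) : R :=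
  match p with Finite q => rpow (powsum q l) (1 / q) | _ => maxabs l end.

Lemma powsum_nonneg q l : 0 <= powsum q l.
Proof.
induction l as [|x l IH]; simpl; [lra|].
generalize (rpow_nonneg (Rabs x) q); lra.
Qed.

Lemma powsum_app q l l' : powsum q (l ++ l') = powsum q l + powsum q l'.
Proof. induction l as [|x l IH]; simpl; [ring | rewrite IH; ring]. Qed.

Lemma powsum_scal q c l :
  powsum q (map (Rmult c) l) = rpow (Rabs c) q * powsum q l.
Proof.
induction l as [|x l IH]; simpl; [ring|].
rewrite IH, Rabs_mult, rpow_mult by apply Rabs_pos; ring.
Qed.

Lemma powsum_repeat q c n : powsum q (repeat c n) = INR n * rpow (Rabs c) q.
Proof.
induction n as [|n IH]; [simpl; ring|].
rewrite S_INR; simpl; rewrite IH; ring.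
Qed.

Lemma powsum_In q l x : In x l -> rpow (Rabs x) q <= powsum q l.
Proof.
induction l as [|y l IH]; simpl; [tauto|].
generalize (rpow_nonneg (Rabs y) q) (powsum_nonneg q l).
intros H1 H2 [->|H]; [lra | specialize (IH H); lra].
Qed.

Lemma maxabs_nonneg l : 0 <= maxabs l.
Proof.
induction l as [|x l IH]; simpl; [lra|].
apply Rle_trans with (2 := Rmax_r _ _), IH.
Qed.

Lemma maxabs_app l l' : maxabs (l ++ l') = Rmax (maxabs l) (maxabs l').
Proof.
induction l as [|x l IH]; simpl.
- rewrite Rmax_right; [reflexivity | apply maxabs_nonneg].
- rewrite IH, Rmax_assoc; reflexivity.
Qed.

Lemma maxabs_scal c l : maxabs (map (Rmult c) l) = Rabs c * maxabs l.
Proof.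
induction l as [|x l IH]; simpl; [ring|].
rewrite IH, Rabs_mult, RmaxRmult; [reflexivity | apply Rabs_pos].
Qed.

Lemma maxabs_In l x : In x l -> Rabs x <= maxabs l.
Proof.
induction l as [|y l IH]; simpl; [tauto|].
intros [->|H]; [apply Rmax_l | apply Rle_trans with (2 := Rmax_r _ _), IH, H].
Qed.

Lemma maxabs_le l c : 0 <= c -> (forall x, In x l -> Rabs x <= c) -> maxabs l <= c.
Proof.
intros Hc; induction l as [|y l IH]; simpl; intros H; [exact Hc|].
apply Rmax_lub; auto.
Qed.

Lemma maxabs_attained l : l <> nil -> exists x, In x l /\ Rabs x = maxabs l.
Proof.
induction l as [|x l IH]; intros H; [congruence|]; simpl.
destruct (Rle_dec (Rabs x) (maxabs l)) as [Hle|Hle].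
- destruct l as [|y l].
  + exists x; simpl; rewrite Rmax_left by apply Rabs_pos; auto.
  + destruct IH as [z [Hz1 Hz2]]; [discriminate|].
    exists z; rewrite Rmax_right by exact Hle; auto.
- exists x; rewrite Rmax_left by lra; auto.
Qed.

Lemma lp_norm_list p n a : lp_norm p n a = lp_list p (map a (seq 0 n)).
Proof.
assert (Hmax : fmaxabs n a = maxabs (map a (seq 0 n))).
{ induction n as [|n IH]; [reflexivity|].
  rewrite seq_S, map_app, maxabs_app, <- IH; simpl.
  rewrite (Rmax_left (Rabs (a n))) by apply Rabs_pos; reflexivity. }
destruct p as [q| |]; [|exact Hmax | exact Hmax].
simpl; f_equal; clear Hmax.
induction n as [|n IH]; [reflexivity|].
rewrite seq_S, map_app, powsum_app; simpl; rewrite IH; ring.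
Qed.

Lemma lp_list_nonneg p l : 0 <= lp_list p l.
Proof. destruct p; simpl; auto using rpow_nonneg, maxabs_nonneg. Qed.

Lemma lp_list_scal p c l : Rbar_le (Finite 1) p ->
  lp_list p (map (Rmult c) l) = Rabs c * lp_list p l.
Proof.
intros Hp; destruct p as [q| |]; simpl in *; [|apply maxabs_scal | apply maxabs_scal].
rewrite powsum_scal, rpow_mult by auto using rpow_nonneg, powsum_nonneg.
rewrite rpow_rpow by (apply Rabs_pos || (field; lra)); reflexivity.
Qed.

Lemma lp_list_app_zeros p l n : lp_list p (l ++ repeat 0 n) = lp_list p l.
Proof.
assert (Hm : maxabs (l ++ repeat 0 n) = maxabs l).
{ rewrite maxabs_app, Rmax_left; [reflexivity|].
  apply maxabs_le; [apply maxabs_nonneg|]; intros x Hx.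
  apply repeat_spec in Hx; rewrite Hx, Rabs_R0; apply maxabs_nonneg. }
destruct p as [q| |]; simpl; [|exact Hm | exact Hm].
rewrite powsum_app, powsum_repeat, Rabs_R0, rpow_0; f_equal; ring.
Qed.

Lemma lp_list_In p l x : Rbar_le (Finite 1) p -> In x l -> Rabs x <= lp_list p l.
Proof.
intros Hp Hx; destruct p as [q| |]; simpl in *; [|apply maxabs_In, Hx | tauto].
rewrite <- (rpow_rpow (Rabs x) q (1 / q)) by (apply Rabs_pos || (field; lra)).
apply rpow_le; [apply Rlt_le, Rdiv_lt_0_compat; lra|].
split; [apply rpow_nonneg | apply powsum_In, Hx].
Qed.

Lemma map_nth_seq (l : list R) n : (length l <= n)%nat ->
  map (fun k => nth k l 0) (seq 0 n) = l ++ repeat 0 (n - length l).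
Proof.
intros H; apply (nth_ext _ _ 0 0).
- rewrite length_map, length_seq, length_app, repeat_length; lia.
- intros k Hk; rewrite length_map, length_seq in Hk.
  rewrite (nth_indep _ 0 (nth 0 l 0)) by (rewrite length_map, length_seq; exact Hk).
  rewrite (map_nth (fun k => nth k l 0)), seq_nth by exact Hk; simpl.
  destruct (Nat.lt_ge_cases k (length l)) as [Hl|Hl].
  + rewrite app_nth1 by exact Hl; reflexivity.
  + rewrite app_nth2, nth_repeat, nth_overflow by exact Hl; reflexivity.
Qed.

Lemma fsum_zero n f : (forall k, (k < n)%nat -> f k = 0) -> fsum n f = 0.
Proof.
induction n as [|n IH]; intros H; simpl; [reflexivity|].
rewrite IH, H by auto with arith; ring.
Qed.

Lemma fsum_single n f k : (k < n)%nat ->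
  (forall i, (i < n)%nat -> i <> k -> f i = 0) -> fsum n f = f k.
Proof.
induction n as [|n IH]; intros Hk H; [lia|]; simpl.
destruct (Nat.eq_dec k n) as [->|Hn].
- rewrite fsum_zero; [ring|]; intros i Hi; apply H; lia.
- rewrite IH, (H n); [ring | lia | lia | lia |]; intros i Hi; apply H; lia.
Qed.

(** * Counting and the extremal vector *)

(** Real-valued, because the counts are compared with powers (x/s)^q. The weak and the strict count
    are both used: with ties, the rank of an entry is only bracketed by the two. *)
Definition count_ge (s : R) (l : list R) : R :=
  fold_right (fun x c => (if Rle_dec s x then 1 else 0) + c) 0 l.

Definition count_gt (s : R) (l : list R) : R :=
  fold_right (fun x c => (if Rlt_dec s x then 1 else 0) + c) 0 l.

Lemma count_ge_app s l l' : count_ge s (l ++ l') = count_ge s l + count_ge s l'.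
Proof. induction l as [|x l IH]; simpl; [ring | rewrite IH; ring]. Qed.

Lemma count_gt_app s l l' : count_gt s (l ++ l') = count_gt s l + count_gt s l'.
Proof. induction l as [|x l IH]; simpl; [ring | rewrite IH; ring]. Qed.

Lemma count_ge_nonneg s l : 0 <= count_ge s l.
Proof. induction l as [|x l IH]; simpl; [lra|]; destruct (Rle_dec s x); lra. Qed.

Lemma count_gt_le_length s l : count_gt s l <= INR (length l).
Proof.
induction l as [|x l IH]; cbn [count_gt fold_right length]; [simpl; lra|].
fold (count_gt s l); rewrite S_INR; destruct (Rlt_dec s x); lra.
Qed.

Lemma count_gt_antitone s t l : s <= t -> count_gt t l <= count_gt s l.
Proof.
intros H; induction l as [|x l IH]; simpl; [lra|].
destruct (Rlt_dec t x), (Rlt_dec s x); lra.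
Qed.

Lemma count_ge_all s l : (forall x, In x l -> s <= x) -> count_ge s l = INR (length l).
Proof.
induction l as [|x l IH]; intros H; cbn [count_ge fold_right length]; [reflexivity|].
fold (count_ge s l); rewrite S_INR, IH by (intros; apply H; right; assumption).
destruct (Rle_dec s x) as [_|Hn]; [ring|]; destruct Hn; apply H; left; reflexivity.
Qed.

Lemma count_ge_perm s l l' : Permutation l l' -> count_ge s l = count_ge s l'.
Proof. induction 1; simpl; [reflexivity | lra | lra | congruence]. Qed.

Lemma count_gt_perm s l l' : Permutation l l' -> count_gt s l = count_gt s l'.
Proof. induction 1; simpl; [reflexivity | lra | lra | congruence]. Qed.

Lemma extract_min (l : list R) : l <> nil ->
  exists x l', Permutation l (l' ++ x :: nil) /\ forall y, In y l -> x <= y.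
Proof.
induction l as [|x l IH]; intros Hl; [congruence|].
destruct l as [|z l].
- exists x, nil; split; [apply Permutation_refl|].
  intros y [->|[]]; lra.
- destruct IH as [y [l' [Hp Hmin]]]; [discriminate|].
  destruct (Rle_dec x y) as [Hxy|Hxy].
  + exists x, (z :: l); split.
    * apply (Permutation_app_comm (x :: nil)).
    * intros t [->|Ht]; [lra|]; specialize (Hmin t Ht); lra.
  + exists y, (x :: l'); split.
    * apply (perm_skip x Hp).
    * intros t [->|Ht]; [lra|]; auto.
Qed.

(** Sorting in nonincreasing order, recorded only through ranks, which is the form that the counting
    bounds can use. A minimum is put last, where it does not disturb the strict counts at the
    earlier entries. *)
Lemma rank_rearrangement (l : list R) :
  exists l', Permutation l l' /\ forall i, (i < length l)%nat ->
    INR (S i) <= count_ge (nth i l' 0) l /\ count_gt (nth i l' 0) l <= INR i.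
Proof.
remember (length l) as n eqn:Hn; revert l Hn.
induction n as [|n IH]; intros l Hn.
- exists l; split; [apply Permutation_refl | intros; lia].
- destruct (extract_min l) as [x [l1 [Hp Hmin]]];
    [destruct l; [discriminate Hn | discriminate]|].
  assert (Hlen : n = length l1)
    by (apply Permutation_length in Hp; rewrite length_app in Hp; simpl in Hp; lia).
  destruct (IH l1 Hlen) as [l2 [Hp2 Hr]].
  assert (Hlen2 := Permutation_length Hp2).
  exists (l2 ++ x :: nil); split.
  { apply Permutation_trans with (1 := Hp), Permutation_app_tail, Hp2. }
  intros i Hi; destruct (Nat.eq_dec i n) as [->|Hin].
  + rewrite app_nth2, Hlen, Hlen2, Nat.sub_diag by lia; cbn [nth]; split.
    * rewrite (count_ge_all x l Hmin); apply le_INR; lia.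
    * rewrite (count_gt_perm _ _ _ Hp), count_gt_app; simpl.
      destruct (Rlt_dec x x); [lra|].
      generalize (count_gt_le_length x l1); rewrite Hlen2; lra.
  + rewrite app_nth1 by lia.
    rewrite (count_ge_perm _ _ _ Hp), (count_gt_perm _ _ _ Hp).
    rewrite count_ge_app, count_gt_app.
    destruct (Hr i ltac:(lia)) as [H1 H2].
    assert (Hx : x <= nth i l2 0).
    { apply Hmin, (Permutation_in _ (Permutation_sym Hp)), in_or_app; left.
      apply (Permutation_in _ (Permutation_sym Hp2)), nth_In; lia. }
    split; [generalize (count_ge_nonneg (nth i l2 0) (x :: nil)); lra|].
    simpl; destruct (Rlt_dec (nth i l2 0) x); lra.
Qed.

(* The extremal vector [(k+1)^(-1/q)], whose decreasing rearrangement is stable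
   under taking disjoint combinations of its copies. *)
Definition zipf (q : R) (k : nat) : R := Rpower (INR (S k)) (- (1 / q)).

Definition zipf_list (q : R) (s n : nat) : list R := map (zipf q) (seq s n).

(** Products in row order, so the part belonging to one entry of [a] is contiguous; in (a) these
    parts become the blocks. *)
Definition outer (a v : list R) : list R := flat_map (fun x => map (Rmult x) v) a.

Lemma zipf_pos q k : 0 < zipf q k.
Proof. apply Rpower_pos. Qed.

Lemma zipf_inv q k : zipf q k = / rpow (INR (S k)) (1 / q).
Proof.
rewrite rpow_pos_eq by (apply lt_0_INR; lia); apply Rpower_Ropp.
Qed.

Lemma rpow_zipf q k : 1 <= q -> rpow (Rabs (zipf q k)) q = / INR (S k).
Proof.
intros Hq; assert (Hk : 0 < INR (S k)) by (apply lt_0_INR; lia).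
rewrite Rabs_right by apply Rle_ge, Rlt_le, zipf_pos.
rewrite rpow_pos_eq by apply zipf_pos; unfold zipf; rewrite Rpower_mult.
replace (- (1 / q) * q) with (Ropp 1) by (field; lra).
rewrite Rpower_Ropp, Rpower_1 by exact Hk; reflexivity.
Qed.

Lemma zipf_list_app q s n m :
  zipf_list q s (n + m) = zipf_list q s n ++ zipf_list q (s + n) m.
Proof. unfold zipf_list; rewrite seq_app; apply map_app. Qed.

Lemma zipf_list_length q s n : length (zipf_list q s n) = n.
Proof. unfold zipf_list; rewrite length_map; apply length_seq. Qed.

Lemma nth_zipf_list q s n k : (k < n)%nat -> nth k (zipf_list q s n) 0 = zipf q (s + k).
Proof.
intros Hk; unfold zipf_list.
rewrite (nth_indep _ 0 (zipf q 0)) by (rewrite length_map, length_seq; exact Hk).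
rewrite map_nth, seq_nth by exact Hk; reflexivity.
Qed.

Lemma powsum_zipf_le q s n : 1 <= q -> powsum q (zipf_list q s n) <= INR n / INR (S s).
Proof.
intros Hq; induction n as [|n IH]; [simpl; unfold Rdiv; lra|].
replace (S n) with (n + 1)%nat by lia; rewrite zipf_list_app, powsum_app, plus_INR.
cbn [zipf_list seq map powsum fold_right]; rewrite rpow_zipf by exact Hq.
assert (H : / INR (S (s + n)) <= / INR (S s)).
{ apply Rinv_le_contravar; [apply lt_0_INR; lia | apply le_INR; lia]. }
unfold Rdiv in *; simpl (INR 1); lra.
Qed.

(** The q-th powers are the terms of the harmonic series; each dyadic group of 2^j terms, all at
    least 1/2^(j+1), contributes at least 1/2. *)
Lemma powsum_zipf_unbounded q B : 1 <= q ->
  exists N0, forall N, (N0 <= N)%nat -> B <= powsum q (zipf_list q 0 N).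
Proof.
intros Hq.
assert (Hdyadic : forall j, INR j / 2 <= powsum q (zipf_list q 0 (2 ^ j))).
{ induction j as [|j IH]; [generalize (powsum_nonneg q (zipf_list q 0 (2 ^ 0))); simpl; lra|].
  replace (2 ^ S j)%nat with (2 ^ j + 2 ^ j)%nat by (simpl; lia).
  rewrite zipf_list_app, powsum_app, S_INR.
  enough (forall n, (n <= 2 ^ j)%nat ->
    INR n * / INR (2 ^ j + 2 ^ j) <= powsum q (zipf_list q (0 + 2 ^ j) n)) as Hh.
  { specialize (Hh (2 ^ j)%nat (Nat.le_refl _)); rewrite plus_INR in Hh.
    assert (H0 : 0 < INR (2 ^ j)) by (apply lt_0_INR; generalize (Nat.pow_nonzero 2 j); lia).
    replace (INR (2 ^ j) * / (INR (2 ^ j) + INR (2 ^ j))) with (1 / 2) in Hh by (field; lra).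
    lra. }
  induction n as [|n IHn]; intros Hn; [simpl; lra|].
  replace (S n) with (n + 1)%nat at 2 by lia; rewrite zipf_list_app, powsum_app, S_INR.
  cbn [zipf_list seq map powsum fold_right]; rewrite rpow_zipf by exact Hq.
  assert (H : / INR (2 ^ j + 2 ^ j) <= / INR (S (0 + 2 ^ j + n))).
  { apply Rinv_le_contravar; [apply lt_0_INR; lia | apply le_INR; lia]. }
  specialize (IHn ltac:(lia)); lra. }
destruct (INR_unbounded (2 * B)) as [j Hj].
exists (2 ^ j)%nat; intros N HN.
replace N with (2 ^ j + (N - 2 ^ j))%nat by lia; rewrite zipf_list_app, powsum_app.
generalize (Hdyadic j) (powsum_nonneg q (zipf_list q (0 + 2 ^ j) (N - 2 ^ j))); lra.
Qed.

(** x (k+1)^(-1/q) >= s means k+1 <= (x/s)^q, so the count is the integer part of (x/s)^q, capped at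
    N. *)
Lemma count_ge_zipf q x s N : 1 <= q -> 0 <= x -> 0 < s ->
  count_ge s (map (Rmult x) (zipf_list q 0 N)) <= rpow x q * rpow (/ s) q.
Proof.
intros Hq Hx Hs.
assert (His : 0 < / s) by (apply Rinv_0_lt_compat, Hs).
rewrite <- rpow_mult by lra.
(* The bound by N carries the induction: if the new last entry is counted, then N+1 <= (x/s)^q, and
   N+1 bounds the whole count. *)
enough (H : count_ge s (map (Rmult x) (zipf_list q 0 N)) <= INR N /\
  count_ge s (map (Rmult x) (zipf_list q 0 N)) <= rpow (x * / s) q) by apply H.
induction N as [|N IH]; [simpl; generalize (rpow_nonneg (x * / s) q); lra|].
rewrite S_INR; replace (S N) with (N + 1)%nat by lia.
rewrite zipf_list_app, map_app, count_ge_app.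
cbn [zipf_list seq map count_ge fold_right]; rewrite Nat.add_0_l.
destruct (Rle_dec s (x * zipf q N)) as [Hle|]; [|lra].
enough (INR (S N) <= rpow (x * / s) q) by (rewrite S_INR in *; lra).
assert (HN : 0 < INR (S N)) by (apply lt_0_INR; lia).
rewrite <- (rpow_rpow (INR (S N)) (1 / q) q) by (lra || (field; lra)).
apply rpow_le; [lra|]; split; [apply rpow_nonneg|].
rewrite zipf_inv in Hle.
assert (Hy : 0 < rpow (INR (S N)) (1 / q)) by (rewrite rpow_pos_eq by exact HN; apply Rpower_pos).
apply Rmult_le_reg_r with (s * / rpow (INR (S N)) (1 / q)).
- apply Rmult_lt_0_compat; [exact Hs | apply Rinv_0_lt_compat, Hy].
- replace (rpow (INR (S N)) (1 / q) * (s * / rpow (INR (S N)) (1 / q))) with s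
    by (field; lra).
  replace (x * / s * (s * / rpow (INR (S N)) (1 / q)))
    with (x * / rpow (INR (S N)) (1 / q)) by (field; lra).
  exact Hle.
Qed.

Lemma count_gt_zipf q x s N : 1 <= q -> 0 <= x -> 0 < s ->
  rpow x q * rpow (/ s) q <= INR N ->
  rpow x q * rpow (/ s) q - 1 <= count_gt s (map (Rmult x) (zipf_list q 0 N)).
Proof.
intros Hq Hx Hs.
assert (His : 0 < / s) by (apply Rinv_0_lt_compat, Hs).
rewrite <- rpow_mult by lra.
(* The minimum makes the claim meaningful for short lists: as long as every entry exceeds s the
   count is N, and the first failure gives (x/s)^q <= N+1. *)
enough (H : Rmin (INR N) (rpow (x * / s) q - 1) <=
    count_gt s (map (Rmult x) (zipf_list q 0 N)))
  by (intros HT; rewrite Rmin_right in H; lra).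
induction N as [|N IH].
{ apply Rle_trans with (1 := Rmin_l _ _); simpl; lra. }
rewrite S_INR; replace (S N) with (N + 1)%nat by lia.
rewrite zipf_list_app, map_app, count_gt_app.
cbn [zipf_list seq map count_gt fold_right]; rewrite Nat.add_0_l.
destruct (Rlt_dec s (x * zipf q N)) as [Hlt|Hge].
- revert IH; unfold Rmin; destruct (Rle_dec _ _), (Rle_dec _ _); lra.
- enough (rpow (x * / s) q <= INR (S N))
    by (rewrite S_INR in *; revert IH; unfold Rmin;
        destruct (Rle_dec _ _), (Rle_dec _ _); lra).
  assert (HN : 0 < INR (S N)) by (apply lt_0_INR; lia).
  rewrite <- (rpow_rpow (INR (S N)) (1 / q) q) by (lra || (field; lra)).
  apply rpow_le; [lra|]; split; [apply Rmult_le_pos; lra|].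
  apply Rnot_lt_le in Hge; rewrite zipf_inv in Hge.
  assert (Hy : 0 < rpow (INR (S N)) (1 / q))
    by (rewrite rpow_pos_eq by exact HN; apply Rpower_pos).
  apply Rmult_le_reg_r with (s * / rpow (INR (S N)) (1 / q)).
  + apply Rmult_lt_0_compat; [exact Hs | apply Rinv_0_lt_compat, Hy].
  + replace (rpow (INR (S N)) (1 / q) * (s * / rpow (INR (S N)) (1 / q))) with s
      by (field; lra).
    replace (x * / s * (s * / rpow (INR (S N)) (1 / q)))
      with (x * / rpow (INR (S N)) (1 / q)) by (field; lra).
    exact Hge.
Qed.

(** * Combinations of copies of the extremal vector *)

Lemma outer_length a v : length (outer a v) = (length a * length v)%nat.
Proof.
induction a as [|x a IH]; [reflexivity|]; simpl.
rewrite length_app, length_map, IH; reflexivity.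
Qed.

(** Valid for every j: beyond the last row both sides are 0 by the default value, so it applies at
    an arbitrary index after division by [length v]. *)
Lemma nth_outer a v j k : (k < length v)%nat ->
  nth (j * length v + k) (outer a v) 0 = nth j a 0 * nth k v 0.
Proof.
intros Hk; revert j; induction a as [|x a IH]; intros j.
- rewrite !nth_overflow by (simpl; lia); ring.
- destruct j as [|j]; simpl.
  + rewrite app_nth1 by (rewrite length_map; exact Hk).
    replace 0 with (x * 0) at 1 by ring; apply map_nth.
  + rewrite app_nth2, length_map by (rewrite length_map; lia).
    replace (length v + j * length v + k - length v)%nat
      with (j * length v + k)%nat by lia.
    apply IH.
Qed.

Lemma count_ge_outer q a s N : 1 <= q -> 0 < s ->
  count_ge s (outer (map Rabs a) (zipf_list q 0 N)) <= powsum q a * rpow (/ s) q.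
Proof.
intros Hq Hs; induction a as [|x a IH]; simpl; [lra|].
rewrite count_ge_app.
generalize (count_ge_zipf q (Rabs x) s N Hq (Rabs_pos x) Hs); lra.
Qed.

(** The counts of the rows add up to [powsum q a] times s^(-q), with a rounding loss of at most one
    per row; this loss becomes the index shift in the sorted list. *)
Lemma count_gt_outer q a s N : 1 <= q -> 0 < s ->
  powsum q a * rpow (/ s) q <= INR N ->
  powsum q a * rpow (/ s) q - INR (length a) <=
  count_gt s (outer (map Rabs a) (zipf_list q 0 N)).
Proof.
intros Hq Hs; induction a as [|x a IH]; intros HN; [simpl; lra|].
cbn [powsum fold_right length outer map flat_map] in *.
fold (powsum q a) (outer (map Rabs a) (zipf_list q 0 N)) in *.
rewrite count_gt_app, S_INR.
assert (Hs0 := rpow_nonneg (/ s) q).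
assert (H1 : 0 <= rpow (Rabs x) q * rpow (/ s) q)
  by (apply Rmult_le_pos; auto using rpow_nonneg).
assert (H2 : 0 <= powsum q a * rpow (/ s) q)
  by (apply Rmult_le_pos; auto using powsum_nonneg).
generalize (IH ltac:(lra))
  (count_gt_zipf q (Rabs x) s N Hq (Rabs_pos x) Hs ltac:(lra)); lra.
Qed.

(* A normalized combination [a] of copies of the extremal vector, sorted, lies
   between that vector and its shift by the number of copies. *)
Lemma outer_zipf_sorted q a N : 1 <= q -> powsum q a = 1 ->
  exists l, Permutation (outer (map Rabs a) (zipf_list q 0 N)) l /\
    (forall i, 0 <= nth i l 0) /\
    (forall i, (i < length a * N)%nat -> nth i l 0 <= zipf q i) /\
    (forall i, (i < length a * N)%nat -> (i + length a < N)%nat ->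
       zipf q (length a + i) <= nth i l 0).
Proof.
intros Hq Ha.
set (w := outer (map Rabs a) (zipf_list q 0 N)).
assert (Hw : length w = (length a * N)%nat)
  by (unfold w; rewrite outer_length, length_map, zipf_list_length; reflexivity).
destruct (rank_rearrangement w) as [l [Hp Hrank]].
assert (Hl : forall i, 0 <= nth i l 0).
{ intros i; destruct (Nat.lt_ge_cases i (length l)) as [Hi|Hi];
    [|rewrite nth_overflow by exact Hi; lra].
  assert (Hin : In (nth i l 0) w)
    by (apply (Permutation_in _ (Permutation_sym Hp)), nth_In, Hi).
  unfold w, outer in Hin; apply in_flat_map in Hin; destruct Hin as [x [Hx Hin]].
  apply in_map_iff in Hx; destruct Hx as [y [<- _]].
  apply in_map_iff in Hin; destruct Hin as [z [<- Hz]].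
  unfold zipf_list in Hz; apply in_map_iff in Hz; destruct Hz as [k [<- _]].
  apply Rmult_le_pos; [apply Rabs_pos | apply Rlt_le, zipf_pos]. }
exists l; split; [exact Hp|]; split; [exact Hl|]; split.
- intros i Hi; destruct (Hrank i ltac:(lia)) as [H1 _].
  destruct (Req_dec (nth i l 0) 0) as [->|H0]; [apply Rlt_le, zipf_pos|].
  assert (Hpos : 0 < nth i l 0) by (generalize (Hl i); lra).
  (* With t the i-th sorted entry, i+1 <= [count_ge t w] <= t^(-q), hence t <= (i+1)^(-1/q). *)
  assert (H2 := count_ge_outer q a (nth i l 0) N Hq Hpos); fold w in H2.
  rewrite Ha, Rmult_1_l in H2.
  rewrite zipf_inv, <- (Rinv_inv (nth i l 0)).
  assert (HS : 0 < INR (S i)) by (apply lt_0_INR; lia).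
  assert (Hinv : 0 < / nth i l 0) by (apply Rinv_0_lt_compat, Hpos).
  apply Rinv_le_contravar.
  + rewrite rpow_pos_eq by exact HS; apply Rpower_pos.
  + rewrite <- (rpow_rpow (/ nth i l 0) q (1 / q)) by (lra || (field; lra)).
    apply rpow_le; [apply Rlt_le, Rdiv_lt_0_compat; lra | lra].
- intros i Hi HiN; destruct (Hrank i ltac:(lia)) as [_ H1].
  (* Let n be the length of [a]. An entry below [zipf q (n + i)] would have at least (n+i+1) - n =
     i+1 entries strictly above it, against its rank. *)
  apply Rnot_lt_le; intros Hlt.
  assert (HE : rpow (/ zipf q (length a + i)) q = INR (S (length a + i))).
  { rewrite zipf_inv, Rinv_inv; apply rpow_rpow; [apply pos_INR | field; lra]. }
  assert (H2 := count_gt_outer q a (zipf q (length a + i)) N Hq (zipf_pos _ _)).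
  fold w in H2; rewrite Ha, Rmult_1_l, HE, S_INR, plus_INR in H2.
  assert (H3 : INR (S (length a + i)) <= INR N) by (apply le_INR; lia).
  rewrite S_INR, plus_INR in H3; specialize (H2 H3).
  generalize (count_gt_antitone _ _ w (Rlt_le _ _ Hlt)); lra.
Qed.

Lemma outer_scal_l c a v : outer (map (Rmult c) a) v = map (Rmult c) (outer a v).
Proof.
induction a as [|x a IH]; [reflexivity|]; simpl.
rewrite map_app, map_map, IH; f_equal; apply map_ext; intros y; ring.
Qed.

Lemma outer_scal_r c a v : outer a (map (Rmult c) v) = map (Rmult c) (outer a v).
Proof.
induction a as [|x a IH]; [reflexivity|]; simpl.
rewrite map_app, !map_map, IH; f_equal; apply map_ext; intros y; ring.
Qed.

Lemma map_scal_inv s (l : list R) : s <> 0 -> map (Rmult s) (map (Rmult (/ s)) l) = l.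
Proof.
intros Hs; rewrite map_map.
transitivity (map (fun x => x) l); [|apply map_id].
apply map_ext; intros x; field; exact Hs.
Qed.

Lemma map_scal_0 (l : list R) : (forall x, In x l -> x = 0) -> map (Rmult 0) l = l.
Proof.
intros H; rewrite <- (map_id l) at 2; apply map_ext_in; intros x Hx.
rewrite (H x Hx); ring.
Qed.

(** * Symmetry and order continuity *)

Lemma exists_fresh_nat (l : list nat) : exists i, ~ In i l.
Proof.
exists (S (list_max l)); intros H.
assert (HF := proj1 (list_max_le l (list_max l)) (Nat.le_refl _)).
rewrite Forall_forall in HF; specialize (HF _ H); lia.
Qed.

Lemma NoDup_extend (l : list nat) (k : nat) :
  NoDup l -> (length l <= k)%nat ->
  exists l', NoDup l' /\ length l' = k /\ incl l l'.
Proof.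
intros Hl Hk.
replace k with ((k - length l) + length l)%nat by lia.
induction (k - length l)%nat as [|d [l' [H1 [H2 H3]]]].
- exists l; repeat split; auto using incl_refl.
- destruct (exists_fresh_nat l') as [i Hi].
  exists (i :: l'); repeat split.
  + now constructor.
  + simpl; rewrite H2; reflexivity.
  + now apply incl_tl.
Qed.

Lemma list_of_preimages (S : nat -> Prop) (f : nat -> nat) (A : list nat) :
  (forall j j', S j -> S j' -> f j = f j' -> j = j') ->
  exists l, NoDup l /\ (length l <= length A)%nat /\
    forall j, S j -> In (f j) A -> In j l.
Proof.
intros Hinj; induction A as [|a A [l [H1 [H2 H3]]]].
- exists nil; repeat split; [constructor | auto | simpl; tauto].
- destruct (classic (exists j, S j /\ f j = a /\ ~ In j l)) as [[j [Hj [Ha Hn]]]|Hn].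
  + exists (j :: l); repeat split; [now constructor | simpl; lia |].
    intros i Hi [E|Hin]; [left | right; auto].
    apply Hinj; congruence.
  + exists l; repeat split; [auto | simpl; lia |].
    intros i Hi [E|Hin]; [|auto].
    destruct (classic (In i l)) as [|Hni]; [auto|].
    destruct Hn; exists i; auto.
Qed.

(** A set A deleted from z pulls back along f to at most as many indices of the support of y; padded
    to size k, it leaves a supremum no larger than that of z outside A. *)
Lemma rearr_le (y z : seqR) (f : nat -> nat) :
  (forall j, y j <> 0 -> Rabs (y j) <= Rabs (z (f j))) ->
  (forall j j', y j <> 0 -> y j' <> 0 -> f j = f j' -> j = j') ->
  forall k, Rbar_le (rearr y k) (rearr z k).
Proof.
intros Hdom Hinj k.
unfold rearr at 2.
apply (proj2 (Glb_Rbar_correct _)).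
intros r [A [HA [HAk Hr]]].
destruct (list_of_preimages (fun j => y j <> 0) f A Hinj) as [l [Hl [Hlen Hpre]]].
destruct (NoDup_extend l k Hl) as [A' [HA' [HAk' Hincl]]]; [lia|].
assert (Hz : forall i, ~ In i A -> Rabs (z i) <= r).
{ intros i Hi. unfold sup_outside in Hr.
  destruct (Lub_Rbar_correct (fun s => exists i, ~ In i A /\ s = Rabs (z i))) as [Hub _].
  rewrite Hr in Hub; apply (Hub (Rabs (z i))); eauto. }
assert (Hr0 : 0 <= r).
{ destruct (exists_fresh_nat A) as [i Hi].
  generalize (Hz i Hi) (Rabs_pos (z i)); lra. }
assert (Hy : forall i, ~ In i A' -> Rabs (y i) <= r).
{ intros i Hi.
  destruct (Req_dec (y i) 0) as [E|E].
  - rewrite E, Rabs_R0; exact Hr0.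
  - apply Rle_trans with (1 := Hdom i E).
    apply Hz; intros Hin; apply Hi, Hincl, Hpre; auto. }
destruct (Lub_Rbar_correct (fun s => exists i, ~ In i A' /\ s = Rabs (y i))) as [Hub Hlub].
fold (sup_outside y A') in Hub, Hlub.
assert (Hle : Rbar_le (sup_outside y A') r).
{ apply Hlub; intros s [i [Hi ->]]; apply Hy, Hi. }
(* [rearr] only admits sets with a finite supremum; here it is at most r, and at least |y_i| for an
   index i outside A'. *)
destruct (exists_fresh_nat A') as [i Hi].
assert (Hge : Rbar_le (Rabs (y i)) (sup_outside y A')) by (apply Hub; eauto).
destruct (sup_outside y A') as [s| |] eqn:Es; try contradiction.
apply Rbar_le_trans with (Finite s); [|exact Hle].
apply (proj1 (Glb_Rbar_correct _)).
exists A'; auto.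
Qed.

(** Only the supports have to correspond; zeros may be inserted or deleted freely. *)
Lemma partial_bijection_rearr (y z : seqR) (f g : nat -> nat) :
  (forall j, y j <> 0 -> z (f j) = y j /\ g (f j) = j) ->
  (forall k, z k <> 0 -> y (g k) = z k /\ f (g k) = k) ->
  forall k, rearr y k = rearr z k.
Proof.
intros Hf Hg k; apply Rbar_le_antisym.
- apply (rearr_le y z f).
  + intros j Hj; rewrite (proj1 (Hf j Hj)); lra.
  + intros j j' Hj Hj' E.
    rewrite <- (proj2 (Hf j Hj)), E; apply (Hf j' Hj').
- apply (rearr_le z y g).
  + intros j Hj; rewrite (proj1 (Hg j Hj)); lra.
  + intros j j' Hj Hj' E.
    rewrite <- (proj2 (Hg j Hj)), E; apply (Hg j' Hj').
Qed.

Section SymmetricSpace.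

Context {mem : seqR -> Prop} {nrm : seqR -> R}.
Context (HX : symmetric_seq_space mem nrm).

Lemma mem_seq0 : mem seq0.
Proof. apply HX. Qed.

Lemma mem_add x y : mem x -> mem y -> mem (seq_add x y).
Proof. apply HX. Qed.

Lemma mem_scal c x : mem x -> mem (seq_scal c x).
Proof. apply HX. Qed.

Lemma nrm_nonneg x : mem x -> 0 <= nrm x.
Proof. apply HX. Qed.

Lemma nrm_eq0 x : mem x -> nrm x = 0 -> forall k, x k = 0.
Proof. apply HX. Qed.

Lemma nrm_scal c x : mem x -> nrm (seq_scal c x) = Rabs c * nrm x.
Proof. apply HX. Qed.

Lemma nrm_add x y : mem x -> mem y -> nrm (seq_add x y) <= nrm x + nrm y.
Proof. apply HX. Qed.

Lemma mem_lattice x y :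
  mem x -> (forall k, Rabs (y k) <= Rabs (x k)) -> mem y /\ nrm y <= nrm x.
Proof. apply HX. Qed.

Lemma seq_subE x y : seq_sub x y = seq_add x (seq_scal (-1) y).
Proof.
apply functional_extensionality; intros k; unfold seq_sub, seq_add, seq_scal; ring.
Qed.

Lemma mem_sub x y : mem x -> mem y -> mem (seq_sub x y).
Proof. intros; rewrite seq_subE; auto using mem_add, mem_scal. Qed.

Lemma nrm_sub_comm x y : mem x -> mem y -> nrm (seq_sub x y) = nrm (seq_sub y x).
Proof.
intros Hx Hy.
replace (seq_sub x y) with (seq_scal (-1) (seq_sub y x)).
- rewrite nrm_scal by (apply mem_sub; auto).
  rewrite Rabs_left by lra; ring.
- apply functional_extensionality; intros k; unfold seq_sub, seq_scal; ring.
Qed.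

Lemma nrm_le_add_sub x y : mem x -> mem y -> nrm x <= nrm y + nrm (seq_sub x y).
Proof.
intros Hx Hy.
replace x with (seq_add y (seq_sub x y)) at 1.
- apply nrm_add; auto using mem_sub.
- apply functional_extensionality; intros k; unfold seq_sub, seq_add; ring.
Qed.

Lemma nrm_seq0 : nrm seq0 = 0.
Proof.
replace seq0 with (seq_scal 0 seq0) at 1.
- rewrite nrm_scal by apply mem_seq0; rewrite Rabs_R0; ring.
- apply functional_extensionality; intros k; unfold seq_scal, seq0; ring.
Qed.

(* All invariance properties below are instances of this one: symmetry and the
   lattice property combined, with a relation [P] that matches the support of
   [y] injectively with coordinates of [x]. *)
Lemma domination (P : nat -> nat -> Prop) (x y : seqR) :
  mem x ->
  (forall j, y j <> 0 -> exists k, P j k /\ Rabs (y j) <= Rabs (x k)) ->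
  (forall j j' k, y j <> 0 -> y j' <> 0 -> P j k -> P j' k -> j = j') ->
  mem y /\ nrm y <= nrm x.
Proof.
intros Hx Hdom Hinj.
assert (Hf : exists f : nat -> nat,
  forall j, y j <> 0 -> P j (f j) /\ Rabs (y j) <= Rabs (x (f j))).
{ exists (fun j => epsilon (inhabits 0%nat)
    (fun k => P j k /\ Rabs (y j) <= Rabs (x k))).
  intros j Hj; apply epsilon_spec, Hdom, Hj. }
destruct Hf as [f Hf].
assert (Hg : exists g : nat -> nat, forall j, y j <> 0 -> g (f j) = j).
{ exists (fun k => epsilon (inhabits 0%nat) (fun j => y j <> 0 /\ f j = k)).
  intros j Hj.
  destruct (epsilon_spec (inhabits 0%nat) (fun i => y i <> 0 /\ f i = f j)) as [H1 H2];
    [eauto|].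
  apply (Hinj _ _ (f j)); auto; [|apply Hf; auto].
  generalize (proj1 (Hf _ H1)); rewrite H2; auto. }
destruct Hg as [g Hg].
(* z is y transported along f, the test picking out the image of f, outside which g is arbitrary.
   The lattice property compares z with x, symmetry compares y with z. *)
set (z := fun k => if Nat.eq_dec (f (g k)) k then y (g k) else 0).
assert (Hz : mem z /\ nrm z <= nrm x).
{ apply mem_lattice; [exact Hx|]; intros k; unfold z.
  destruct (Nat.eq_dec (f (g k)) k) as [E|E];
    [|rewrite Rabs_R0; apply Rabs_pos].
  destruct (Req_dec (y (g k)) 0) as [E0|E0];
    [rewrite E0, Rabs_R0; apply Rabs_pos|].
  rewrite <- E at 2; apply Hf, E0. }
assert (Hr : forall k, rearr y k = rearr z k).
{ apply (partial_bijection_rearr y z f g).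
  - intros j Hj; unfold z; rewrite (Hg j Hj).
    destruct (Nat.eq_dec (f j) (f j)); intuition.
  - intros k; unfold z; destruct (Nat.eq_dec (f (g k)) k); intuition. }
destruct HX as [_ [_ Hsym]].
destruct (Hsym z y (proj1 Hz) Hr) as [Hy1 Hy2].
split; [exact Hy1 | rewrite Hy2; apply Hz].
Qed.

Definition slice (a b : nat) (x : seqR) : seqR :=
  fun i => if andb (Nat.leb a i) (Nat.ltb i b) then x i else 0.

Lemma slice_in a b x i : (a <= i < b)%nat -> slice a b x i = x i.
Proof.
intros H; unfold slice.
destruct (Nat.leb_spec a i); [|lia]; destruct (Nat.ltb_spec i b); [|lia]; reflexivity.
Qed.

Lemma slice_out a b x i : ~ (a <= i < b)%nat -> slice a b x i = 0.
Proof.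
intros H; unfold slice.
destruct (Nat.leb_spec a i); simpl; [|reflexivity].
destruct (Nat.ltb_spec i b); [lia|reflexivity].
Qed.

Lemma mem_slice a b x : mem x -> mem (slice a b x) /\ nrm (slice a b x) <= nrm x.
Proof.
intros Hx; apply mem_lattice; [exact Hx|]; intros k; unfold slice.
destruct (andb _ _); [lra | rewrite Rabs_R0; apply Rabs_pos].
Qed.

(* If the slices stayed large, infinitely many disjoint ones could be switched
   on and off independently, and a diagonal choice of switches would keep their
   sum away from every member of a countable dense family. *)
Lemma slices_vanish x delta :
  separable mem nrm -> mem x -> 0 < delta ->
  exists N, forall a b, (N <= a)%nat -> nrm (slice a b x) < delta.
Proof.
intros [d [Hd Hdense]] Hx Hdelta.
apply NNPP; intros Hn.
assert (HAB : exists AB : nat -> nat * nat, forall N, (N <= fst (AB N))%nat /\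
  delta <= nrm (slice (fst (AB N)) (snd (AB N)) x)).
{ apply (choice (fun N ab => (N <= fst ab)%nat /\ delta <= nrm (slice (fst ab) (snd ab) x))).
  intros N; apply NNPP; intros Hab; apply Hn; exists N; intros a b Ha.
  apply Rnot_le_lt; intros Hle; apply Hab; exists (a, b); auto. }
destruct HAB as [AB HAB].
set (s := fix s n := match n with O => O | S m => Nat.max (s m) (snd (AB (s m))) end).
set (a := fun n => fst (AB (s n))).
set (b := fun n => snd (AB (s n))).
assert (Hsb : forall n m, (n < m)%nat -> (b n <= s m)%nat).
{ intros n m Hnm; induction Hnm as [|m Hnm IH].
  - change (s (S n)) with (Nat.max (s n) (b n)); lia.
  - change (s (S m)) with (Nat.max (s m) (b m)); lia. }
assert (Huniq : forall n m i, (a n <= i < b n)%nat -> (a m <= i < b m)%nat -> n = m).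
{ intros n m i H1 H2.
  generalize (Hsb n m) (Hsb m n) (proj1 (HAB (s n))) (proj1 (HAB (s m))).
  fold (a n) (a m); lia. }
(* The diagonal choice: slice n of x is kept exactly when [d n] is small there. Either way y and
   [d n] differ by at least delta/2 on that interval. *)
set (sw := fun n => nrm (slice (a n) (b n) (d n)) < delta / 2).
set (y := fun i => if excluded_middle_informative
   (exists n, (a n <= i < b n)%nat /\ sw n) then x i else 0).
assert (Hy : mem y).
{ apply (mem_lattice x); [exact Hx|]; intros k; unfold y.
  destruct (excluded_middle_informative _);
    [lra | rewrite Rabs_R0; apply Rabs_pos]. }
destruct (Hdense y Hy (delta / 2)) as [n Hnd]; [lra|].
assert (Hyd : mem (seq_sub y (d n))) by (apply mem_sub; auto).
destruct (mem_slice (a n) (b n) _ Hyd) as [Hm1 Hm2].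
destruct (mem_slice (a n) (b n) _ (Hd n)) as [Hm3 _].
destruct (mem_slice (a n) (b n) _ Hx) as [Hm4 _].
destruct (classic (sw n)) as [Hsw|Hsw].
- assert (H1 := nrm_le_add_sub _ _ Hm4 Hm3).
  replace (seq_sub (slice (a n) (b n) x) (slice (a n) (b n) (d n)))
    with (slice (a n) (b n) (seq_sub y (d n))) in H1.
  + generalize (proj2 (HAB (s n))); fold (a n) (b n); unfold sw in Hsw; lra.
  + apply functional_extensionality; intros i; unfold seq_sub.
    destruct (classic (a n <= i < b n)%nat) as [Hi|Hi].
    * rewrite !slice_in by exact Hi; unfold y.
      destruct (excluded_middle_informative _) as [|E]; [reflexivity|].
      destruct E; eauto.
    * rewrite !slice_out by exact Hi; ring.
- apply Hsw; unfold sw.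
  apply Rle_lt_trans with (2 := Hnd), Rle_trans with (2 := Hm2).
  apply mem_lattice; [exact Hm1|]; intros i.
  destruct (classic (a n <= i < b n)%nat) as [Hi|Hi].
  + rewrite !slice_in by exact Hi; unfold seq_sub, y.
    destruct (excluded_middle_informative _) as [[m [H1 H2]]|E].
    * destruct Hsw; rewrite (Huniq n m i); auto.
    * rewrite Rminus_0_l, Rabs_Ropp; lra.
  + rewrite !slice_out by exact Hi; lra.
Qed.

Lemma head_approximation x eps :
  separable mem nrm -> mem x -> 0 < eps ->
  exists r, nrm (seq_sub x (slice 0 r x)) < eps.
Proof.
intros Hsep Hx Heps.
assert (Hh : forall n, mem (slice 0 n x)) by (intros n; apply mem_slice, Hx).
destruct HX as [[[_ [_ [_ [_ [_ [_ [_ Hcomplete]]]]]]] _] _].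
destruct (Hcomplete (fun n => slice 0 n x) Hh) as [y [Hy Hlim]].
{ intros e He; destruct (slices_vanish x e Hsep Hx He) as [N HN].
  exists N; intros m n Hm Hn.
  apply Rle_lt_trans with (2 := HN (Nat.min m n) (Nat.max m n) ltac:(lia)).
  apply mem_lattice; [apply mem_slice, Hx|]; intros i; unfold seq_sub.
  destruct (classic (Nat.min m n <= i < Nat.max m n)%nat) as [Hi|Hi].
  - rewrite (slice_in (Nat.min m n)) by exact Hi.
    destruct (classic (i < m)%nat).
    + rewrite (slice_in 0 m), (slice_out 0 n) by lia; rewrite Rminus_0_r; lra.
    + rewrite (slice_out 0 m), (slice_in 0 n) by lia.
      rewrite Rminus_0_l, Rabs_Ropp; lra.
  - rewrite (slice_out (Nat.min m n)) by exact Hi.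
    destruct (classic (i < m)%nat).
    + rewrite (slice_in 0 m), (slice_in 0 n) by lia.
      rewrite Rminus_diag, Rabs_R0; lra.
    + rewrite (slice_out 0 m), (slice_out 0 n) by lia.
      rewrite Rminus_0_r, Rabs_R0; lra. }
assert (Hxy : mem (seq_sub x y)) by (apply mem_sub; auto).
(* Heads longer than k agree with x at k, so the k-th coordinate of x - y is dominated by every late
   difference between a head and y, and those tend to 0. *)
assert (E : x = y).
{ apply functional_extensionality; intros k.
  destruct (mem_slice k (S k) _ Hxy) as [Hw _].
  destruct (Req_dec (nrm (slice k (S k) (seq_sub x y))) 0) as [E0|E0].
  - generalize (nrm_eq0 _ Hw E0 k); rewrite slice_in by lia; unfold seq_sub; lra.
  - assert (Hpos : 0 < nrm (slice k (S k) (seq_sub x y)))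
      by (generalize (nrm_nonneg _ Hw); lra).
    destruct (Hlim _ Hpos) as [N HN].
    specialize (HN (Nat.max N (S k)) ltac:(lia)).
    exfalso; apply (Rlt_irrefl (nrm (slice k (S k) (seq_sub x y)))).
    apply Rle_lt_trans with (2 := HN).
    apply mem_lattice; [apply mem_sub; auto|]; intros i.
    destruct (Nat.eq_dec i k) as [->|Hi].
    + rewrite slice_in by lia; unfold seq_sub; rewrite slice_in by lia; lra.
    + rewrite slice_out by lia; rewrite Rabs_R0; apply Rabs_pos. }
subst y; destruct (Hlim eps Heps) as [N HN]; exists N.
rewrite nrm_sub_comm; auto.
Qed.

(** * Disjoint copies *)

(* An array on nat * nat, read as one sequence through the Cantor pairing. *)
Definition arr (U : nat -> nat -> R) : seqR :=
  fun j => U (fst (of_nat j)) (snd (of_nat j)).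

Definition copies (u : seqR) (l : list R) : seqR :=
  arr (fun k i => nth k l 0 * u i).

Definition copies_nrm (u : seqR) (l : list R) : R := nrm (copies u l).

Lemma arr_to_nat U k i : arr U (to_nat (k, i)) = U k i.
Proof. unfold arr; rewrite cancel_of_to; reflexivity. Qed.

Lemma arr_add U V : arr (fun k i => U k i + V k i) = seq_add (arr U) (arr V).
Proof. reflexivity. Qed.

Lemma to_nat_pair_inj k i k' i' :
  to_nat (k, i) = to_nat (k', i') -> k = k' /\ i = i'.
Proof.
intros E; assert (E' : (k, i) = (k', i'))
  by (rewrite <- (cancel_of_to (k, i)), E; apply cancel_of_to).
injection E'; auto.
Qed.

Lemma nat_pair_eq j j' :
  fst (of_nat j) = fst (of_nat j') -> snd (of_nat j) = snd (of_nat j') -> j = j'.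
Proof.
intros H1 H2; rewrite <- (cancel_to_of j), <- (cancel_to_of j'); f_equal.
destruct (of_nat j), (of_nat j'); simpl in *; congruence.
Qed.

Lemma domination_arr (x y : nat -> nat -> R) (f g : nat -> nat -> nat) :
  mem (arr x) ->
  (forall k i, y k i <> 0 -> Rabs (y k i) <= Rabs (x (f k i) (g k i))) ->
  (forall k i k' i', y k i <> 0 -> y k' i' <> 0 ->
     f k i = f k' i' -> g k i = g k' i' -> k = k' /\ i = i') ->
  mem (arr y) /\ nrm (arr y) <= nrm (arr x).
Proof.
intros Hx Hdom Hinj.
apply (domination (fun j m => m = to_nat
  (f (fst (of_nat j)) (snd (of_nat j)), g (fst (of_nat j)) (snd (of_nat j))))
  (arr x) (arr y) Hx).
- intros j Hj; eexists; split; [reflexivity|].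
  rewrite arr_to_nat; apply Hdom, Hj.
- intros j j' m Hj Hj' -> E.
  apply to_nat_pair_inj in E.
  destruct (Hinj _ _ _ _ Hj Hj' (proj1 E) (proj2 E)); apply nat_pair_eq; auto.
Qed.

Lemma mem_copies_single u c : mem u ->
  mem (copies u (c :: nil)) /\ copies_nrm u (c :: nil) <= Rabs c * nrm u.
Proof.
intros Hu; unfold copies_nrm; rewrite <- nrm_scal by exact Hu.
assert (H0 : forall j, copies u (c :: nil) j <> 0 -> fst (of_nat j) = 0%nat).
{ intros j Hj; unfold copies, arr in Hj.
  destruct (fst (of_nat j)) as [|[|n]]; [reflexivity | |];
    destruct Hj; simpl; ring. }
apply (domination (fun j i => i = snd (of_nat j))).
- apply mem_scal, Hu.
- intros j Hj; eexists; split; [reflexivity|].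
  unfold copies, arr, seq_scal; rewrite (H0 j Hj); simpl; lra.
- intros j j' i Hj Hj' -> E.
  apply nat_pair_eq; [rewrite (H0 j), (H0 j') by auto|]; auto.
Qed.

Lemma nth_nonzero_lt k (l : list R) : nth k l 0 <> 0 -> (k < length l)%nat.
Proof.
intros H; destruct (Nat.lt_ge_cases k (length l)) as [|Hk]; [assumption|].
destruct H; apply nth_overflow, Hk.
Qed.

(** The leading zeros send the copies for [l2] to later rows, where they do not meet those for
    [l1]. *)
Lemma copies_app u l1 l2 :
  copies u (l1 ++ l2) =
  seq_add (copies u l1) (copies u (repeat 0 (length l1) ++ l2)).
Proof.
unfold copies; rewrite <- arr_add; f_equal.
apply functional_extensionality; intros k.
apply functional_extensionality; intros i.
destruct (Nat.lt_ge_cases k (length l1)) as [Hk|Hk].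
- rewrite !app_nth1 by (rewrite ?repeat_length; exact Hk).
  rewrite nth_repeat; ring.
- rewrite !app_nth2, (nth_overflow l1) by (rewrite ?repeat_length; exact Hk).
  rewrite repeat_length; ring.
Qed.

Lemma mem_copies_shift u l n : mem (copies u l) ->
  mem (copies u (repeat 0 n ++ l)) /\
  copies_nrm u (repeat 0 n ++ l) <= copies_nrm u l.
Proof.
intros H; apply (domination_arr (fun k i => nth k l 0 * u i) _
  (fun k _ => (k - n)%nat) (fun _ i => i) H).
- intros k i Hk.
  destruct (Nat.lt_ge_cases k n) as [Hn|Hn].
  + destruct Hk; rewrite app_nth1, nth_repeat by (rewrite repeat_length; exact Hn).
    ring.
  + rewrite app_nth2, repeat_length by (rewrite repeat_length; exact Hn); lra.
- intros k i k' i' Hk Hk' E ->; split; [|reflexivity].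
  enough (forall m, nth m (repeat 0 n ++ l) 0 * u i' <> 0 -> (n <= m)%nat) as Hn
    by (generalize (Hn k Hk) (Hn k' Hk'); lia).
  intros m Hm; destruct (Nat.lt_ge_cases m n) as [Hmn|]; [|assumption].
  destruct Hm; rewrite app_nth1, nth_repeat by (rewrite repeat_length; exact Hmn).
  ring.
Qed.

Lemma copies_nil u : copies u nil = seq0.
Proof.
apply functional_extensionality; intros j; unfold copies, arr, seq0.
destruct (fst (of_nat j)); simpl; ring.
Qed.

Lemma mem_copies u l : mem u -> mem (copies u l).
Proof.
intros Hu; induction l as [|c l IH].
- rewrite copies_nil; apply mem_seq0.
- change (c :: l) with ((c :: nil) ++ l); rewrite copies_app.
  apply mem_add; [apply mem_copies_single, Hu | apply mem_copies_shift, IH].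
Qed.

Lemma copies_nrm_nonneg u l : mem u -> 0 <= copies_nrm u l.
Proof. intros Hu; apply nrm_nonneg, mem_copies, Hu. Qed.

Lemma copies_nrm_dominated u l l' (f : nat -> nat) : mem u ->
  (forall k, nth k l 0 <> 0 -> Rabs (nth k l 0) <= Rabs (nth (f k) l' 0)) ->
  (forall k k', nth k l 0 <> 0 -> nth k' l 0 <> 0 -> f k = f k' -> k = k') ->
  copies_nrm u l <= copies_nrm u l'.
Proof.
intros Hu Hdom Hinj.
apply (domination_arr _ (fun k i => nth k l 0 * u i)
  (fun k _ => f k) (fun _ i => i) (mem_copies u l' Hu)).
- intros k i Hk; rewrite !Rabs_mult.
  apply Rmult_le_compat_r; [apply Rabs_pos|].
  apply Hdom; intros E; apply Hk; rewrite E; ring.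
- intros k i k' i' Hk Hk' E ->; split; [|reflexivity].
  apply Hinj; auto; intros E0; [apply Hk | apply Hk']; rewrite E0; ring.
Qed.

Lemma copies_nrm_perm u l l' : mem u ->
  Permutation l l' -> copies_nrm u l = copies_nrm u l'.
Proof.
intros Hu.
enough (H : forall l l', Permutation l l' -> copies_nrm u l' <= copies_nrm u l)
  by (intros Hp; apply Rle_antisym; apply H; [apply Permutation_sym|]; exact Hp).
clear l l'; intros l l' Hp.
apply (Permutation_nth l l' 0) in Hp; destruct Hp as [Hlen [f [Hf [Hinj Hnth]]]].
apply (copies_nrm_dominated u l' l f Hu).
- intros k Hk; apply nth_nonzero_lt in Hk.
  rewrite Hnth by lia; lra.
- intros k k' Hk Hk' E; apply nth_nonzero_lt in Hk; apply nth_nonzero_lt in Hk'.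
  apply Hinj; lia || exact E.
Qed.

Lemma copies_nrm_le u l l' : mem u ->
  (forall k, Rabs (nth k l 0) <= Rabs (nth k l' 0)) ->
  copies_nrm u l <= copies_nrm u l'.
Proof. intros Hu H; apply (copies_nrm_dominated u l l' (fun k => k)); auto. Qed.

Lemma copies_nrm_app_le u l1 l2 : mem u ->
  copies_nrm u (l1 ++ l2) <= copies_nrm u l1 + copies_nrm u l2.
Proof.
intros Hu; unfold copies_nrm at 1; rewrite copies_app.
eapply Rle_trans; [apply nrm_add; apply mem_copies, Hu|].
apply Rplus_le_compat_l, mem_copies_shift, mem_copies, Hu.
Qed.

Lemma copies_nrm_app_l u l1 l2 : mem u -> copies_nrm u l1 <= copies_nrm u (l1 ++ l2).
Proof.
intros Hu; apply (copies_nrm_dominated u _ _ (fun k => k)); auto.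
intros k Hk; rewrite app_nth1 by apply nth_nonzero_lt, Hk; lra.
Qed.

Lemma copies_nrm_app_r u l1 l2 : mem u -> copies_nrm u l2 <= copies_nrm u (l1 ++ l2).
Proof.
intros Hu; rewrite (copies_nrm_perm u (l1 ++ l2) (l2 ++ l1) Hu)
  by apply Permutation_app_comm.
apply copies_nrm_app_l, Hu.
Qed.

Lemma copies_nrm_scal u c l : mem u ->
  copies_nrm u (map (Rmult c) l) = Rabs c * copies_nrm u l.
Proof.
intros Hu; unfold copies_nrm; rewrite <- nrm_scal by apply mem_copies, Hu.
f_equal; unfold copies, arr; apply functional_extensionality; intros j; unfold seq_scal.
replace 0 with (c * 0) at 1 by ring; rewrite map_nth; ring.
Qed.

Lemma copies_nrm_single u c : mem u -> copies_nrm u (c :: nil) = Rabs c * nrm u.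
Proof.
intros Hu; apply Rle_antisym; [apply mem_copies_single, Hu|].
rewrite <- nrm_scal by exact Hu.
apply (domination (fun i j => j = to_nat (0%nat, i))).
- apply mem_copies, Hu.
- intros i _; eexists; split; [reflexivity|].
  unfold copies; rewrite arr_to_nat; simpl; unfold seq_scal; lra.
- intros i i' j _ _ -> E; apply to_nat_pair_inj in E; apply E.
Qed.

Definition sum_abs (l : list R) : R := fold_right (fun x s => Rabs x + s) 0 l.

Lemma copies_nrm_le_sum_abs u l : mem u -> copies_nrm u l <= sum_abs l * nrm u.
Proof.
intros Hu; induction l as [|c l IH]; simpl.
- unfold copies_nrm; rewrite copies_nil, nrm_seq0; lra.
- change (c :: l) with ((c :: nil) ++ l).
  eapply Rle_trans; [apply copies_nrm_app_le, Hu|].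
  rewrite copies_nrm_single by exact Hu; lra.
Qed.

Lemma copies_nrm_perturb u v l : mem u -> mem v ->
  copies_nrm u l <= copies_nrm v l + sum_abs l * nrm (seq_sub u v).
Proof.
intros Hu Hv.
eapply Rle_trans; [apply nrm_le_add_sub; apply mem_copies; [exact Hu | exact Hv]|].
apply Rplus_le_compat_l.
replace (seq_sub (copies u l) (copies v l)) with (copies (seq_sub u v) l).
- apply copies_nrm_le_sum_abs, mem_sub; auto.
- apply functional_extensionality; intros j; unfold copies, arr, seq_sub; ring.
Qed.

Definition split_col (u : seqR) (c : R) (l : list R) : seqR :=
  arr (fun k i => match k with O => c * Dop u i | S k' => nth k' l 0 * u i end).

(** With indices from 0, [Dop u] vanishes at 0 and carries u_i at 2i+1 and 2i+2: its odd and its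
    even places are two disjoint copies of [u]. *)
Lemma split_col_copies u c l : mem u ->
  mem (split_col u c l) /\ nrm (split_col u c l) = copies_nrm u (c :: c :: l).
Proof.
intros Hu.
assert (Hle : mem (split_col u c l) /\
  nrm (split_col u c l) <= copies_nrm u (c :: c :: l)).
(* The parity of the place selects one of the first two rows; the remaining rows move down by
   one. *)
{ apply (domination_arr (fun k i => nth k (c :: c :: l) 0 * u i) _
    (fun k i => match k with O => (i mod 2)%nat | S k' => S (S k') end)
    (fun k i => match k with O => ((i + 1) / 2 - 1)%nat | S _ => i end)).
  - apply mem_copies, Hu.
  - intros [|k] i H; [|simpl; lra].
    destruct i as [|i]; [destruct H; simpl; ring|].
    unfold Dop; generalize (Nat.mod_upper_bound (S i) 2 ltac:(lia)).
    destruct (S i mod 2)%nat as [|[|m]]; [simpl; lra | simpl; lra | lia].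
  - intros [|k] i [|k'] i' H H' E1 E2.
    + split; [reflexivity|].
      destruct i as [|i]; [destruct H; simpl; ring|].
      destruct i' as [|i']; [destruct H'; simpl; ring|].
      generalize (Nat.div_mod_eq (S i) 2) (Nat.div_mod_eq (S i') 2)
        (Nat.div_mod_eq (S i + 1) 2) (Nat.div_mod_eq (S i' + 1) 2)
        (Nat.mod_upper_bound (S i + 1) 2 ltac:(lia))
        (Nat.mod_upper_bound (S i' + 1) 2 ltac:(lia))
        (Nat.mod_upper_bound (S i) 2 ltac:(lia)); lia.
    + generalize (Nat.mod_upper_bound i 2 ltac:(lia)); lia.
    + generalize (Nat.mod_upper_bound i' 2 ltac:(lia)); lia.
    + split; lia. }
split; [apply Hle|]; apply Rle_antisym; [apply Hle|].
(* The inverse matching: row 0 fills the even places, row 1 the odd ones. *)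
apply (domination_arr _ (fun k i => nth k (c :: c :: l) 0 * u i)
    (fun k i => match k with O => O | S k' => k' end)
    (fun k i => match k with O => 2 * i + 2 | S O => 2 * i + 1 | _ => i end)%nat
    (proj1 Hle)).
- assert (HD : forall i m, (i < m)%nat -> Dop u m = u ((m + 1) / 2 - 1)%nat)
    by (intros i [|m] Hm; [lia|reflexivity]).
  assert (HE : forall i, ((2 * i + 2 + 1) / 2 - 1 = i)%nat)
    by (intros i; generalize (Nat.div_mod_eq (2 * i + 2 + 1) 2)
          (Nat.mod_upper_bound (2 * i + 2 + 1) 2 ltac:(lia)); lia).
  assert (HO : forall i, ((2 * i + 1 + 1) / 2 - 1 = i)%nat)
    by (intros i; generalize (Nat.div_mod_eq (2 * i + 1 + 1) 2)
          (Nat.mod_upper_bound (2 * i + 1 + 1) 2 ltac:(lia)); lia).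
  intros [|[|k]] i _; cbv beta iota.
  + rewrite (HD i), HE by lia; simpl; lra.
  + rewrite (HD i), HO by lia; simpl; lra.
  + simpl; lra.
- intros [|[|k]] i [|[|k']] i' _ _ E1 E2; split; lia.
Qed.

Lemma mem_Dop u : mem u -> mem (Dop u).
Proof.
intros Hu.
apply (domination (fun i j => j = to_nat (0%nat, i)) (split_col u 1 nil)).
- apply split_col_copies, Hu.
- intros i _; eexists; split; [reflexivity|].
  unfold split_col; rewrite arr_to_nat, Rmult_1_l; lra.
- intros i i' j _ _ -> E; apply to_nat_pair_inj in E; apply E.
Qed.

(* If [u] is nearly an eigenvector of [Dop], a copy of [u] weighted [lam * c]
   may be traded for two copies weighted [c]. *)
Lemma copies_nrm_split u lam c l : mem u ->
  Rabs (copies_nrm u (c :: c :: l) - copies_nrm u (lam * c :: l)) <=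
  Rabs c * nrm (seq_sub (Dop u) (seq_scal lam u)).
Proof.
intros Hu.
destruct (split_col_copies u c l Hu) as [Hs <-].
assert (Hc := mem_copies u (lam * c :: l) Hu).
assert (Hw : mem (seq_sub (Dop u) (seq_scal lam u)))
  by auto using mem_sub, mem_Dop, mem_scal.
assert (E : seq_sub (split_col u c l) (copies u (lam * c :: l)) =
  copies (seq_sub (Dop u) (seq_scal lam u)) (c :: nil)).
{ apply functional_extensionality; intros j.
  unfold seq_sub, split_col, copies, arr, seq_scal.
  destruct (fst (of_nat j)) as [|[|k]]; simpl; ring. }
assert (H1 := nrm_le_add_sub _ _ Hs Hc).
assert (H2 := nrm_le_add_sub _ _ Hc Hs).
rewrite (nrm_sub_comm _ _ Hc Hs) in H2; rewrite E in H1, H2.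
assert (H3 := proj2 (mem_copies_single _ c Hw)).
unfold copies_nrm in *; apply Rabs_le; lra.
Qed.

(** * Estimates for copies, compared with disjoint rearrangements *)

Definition lp_copies_estimate (p : Rbar) (C : R) (M : nat) (u : seqR) : Prop :=
  mem u /\ forall l, (length l <= M)%nat ->
    / C * lp_list p l <= copies_nrm u l /\ copies_nrm u l <= C * lp_list p l.

(** The hub of the equivalence: it follows from (c) and from (d), and it implies (a) and (d). C does
    not depend on M, whereas [u] and its support may. *)
Definition lp_copies (p : Rbar) : Prop :=
  exists C, 0 < C /\ forall M, exists (u : seqR) (r : nat),
    lp_copies_estimate p C M u /\ (forall i, (r <= i)%nat -> u i = 0).

(** Each x_k is a rearrangement of x_0 and the supports are disjoint, so the combination and the
    copies of x_0 differ by a bijection of supports. The size [S n] guarantees that x_0 belongs to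
    the family. *)
Lemma lin_comb_admissible n x l : admissible_family mem (S n) x ->
  (length l <= S n)%nat ->
  nrm (lin_comb (S n) (fun k => nth k l 0) x) = copies_nrm (x O) l.
Proof.
intros [Hm [Hdisj Hdist]] Hl.
assert (Hx0 : mem (x O)) by (apply Hm; lia).
set (c := lin_comb (S n) (fun k => nth k l 0) x).
assert (Hc : forall k j, (k < S n)%nat -> x k j <> 0 -> c j = nth k l 0 * x k j).
{ intros k j Hk Hj; apply (fsum_single (S n) (fun k => nth k l 0 * x k j) k Hk).
  intros i Hi Hik; rewrite (Hdisj k i j); auto; ring. }
assert (Hc0 : forall j, c j <> 0 -> exists k, (k < S n)%nat /\ x k j <> 0).
{ intros j Hj; apply NNPP; intros Hn; apply Hj, fsum_zero; intros k Hk.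
  destruct (Req_dec (x k j) 0) as [->|E]; [ring|]; destruct Hn; eauto. }
destruct (choice (fun k (f : (nat -> nat) * (nat -> nat)) => (k < S n)%nat ->
  (forall j, snd f (fst f j) = j) /\ (forall j, fst f (snd f j) = j) /\
  (forall j, x k (fst f j) = x O j))) as [f Hf].
{ intros k; destruct (Nat.lt_ge_cases k (S n)) as [Hk|Hk].
  - destruct (Hdist O k ltac:(lia) Hk) as [g [h H]]; exists (g, h); auto.
  - exists (fun i => i, fun i => i); intros; lia. }
assert (Hle : mem c /\ nrm c <= copies_nrm (x O) l).
(* A place j in the support of x_k goes to row k, at the coordinate of x_0 that the permutation
   sends to j. *)
{ apply (domination (fun j m => exists k, (k < S n)%nat /\ x k j <> 0 /\
    m = to_nat (k, snd (f k) j)) (copies (x O) l)).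
  - apply mem_copies, Hx0.
  - intros j Hj; destruct (Hc0 j Hj) as [k [Hk Hkj]].
    eexists; split; [exists k; eauto|].
    destruct (Hf k Hk) as [_ [H2 H3]].
    unfold copies; rewrite arr_to_nat, (Hc k j Hk Hkj), <- H3, H2; lra.
  - intros j j' m _ _ [k [Hk [_ ->]]] [k' [Hk' [_ E]]].
    apply to_nat_pair_inj in E; destruct E as [<- E].
    destruct (Hf k Hk) as [_ [H2 _]]; rewrite <- (H2 j), E; apply H2. }
apply Rle_antisym; [apply Hle|].
assert (Hs : forall j, copies (x O) l j <> 0 ->
  let (k, i) := of_nat j in (k < S n)%nat /\ x k (fst (f k) i) <> 0).
{ intros j; unfold copies, arr; destruct (of_nat j) as [k i]; simpl; intros Hj.
  assert (Hk : (k < S n)%nat).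
  { apply Nat.lt_le_trans with (2 := Hl), nth_nonzero_lt.
    intros E; apply Hj; rewrite E; ring. }
  split; [exact Hk|]; rewrite (proj2 (proj2 (Hf k Hk))).
  intros E; apply Hj; rewrite E; ring. }
apply (domination (fun j m => m =
  fst (f (fst (of_nat j))) (snd (of_nat j))) c (copies (x O) l) (proj1 Hle)).
- intros j Hj; eexists; split; [reflexivity|].
  specialize (Hs j Hj); unfold copies, arr.
  destruct (of_nat j) as [k i]; simpl; destruct Hs as [Hk Hki].
  rewrite (Hc k _ Hk Hki), (proj2 (proj2 (Hf k Hk))); lra.
- intros j j' m Hj Hj' -> E.
  assert (H1 := Hs j Hj); assert (H2 := Hs j' Hj').
  apply nat_pair_eq; destruct (of_nat j) as [k i], (of_nat j') as [k' i'];
    simpl in *; destruct H1 as [H1 H1'], H2 as [H2 H2'];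
    (assert (Hkk : k = k') by (apply NNPP; intros Hn;
      apply H2'; rewrite <- E; apply (Hdisj k k'); auto)); subst k'; [reflexivity|].
  destruct (Hf k H1) as [H3 _]; rewrite <- (H3 i), E; apply H3.
Qed.

Lemma sum_abs_le_lp p l : Rbar_le (Finite 1) p ->
  sum_abs l <= INR (length l) * lp_list p l.
Proof.
intros Hp.
enough (H : forall l', incl l' l -> sum_abs l' <= INR (length l') * lp_list p l)
  by apply H, incl_refl.
induction l' as [|x l' IH]; intros Hi; cbn [sum_abs fold_right length]; [simpl; lra|].
fold (sum_abs l'); rewrite S_INR.
generalize (IH (fun y Hy => Hi y (or_intror Hy)))
  (lp_list_In p l x Hp (Hi x (or_introl eq_refl))); lra.
Qed.

Lemma lp_copies_truncate p C : separable mem nrm -> Rbar_le (Finite 1) p -> 0 < C ->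
  (forall M, exists u, lp_copies_estimate p C M u) -> lp_copies p.
Proof.
intros Hsep Hp HC Hcop.
assert (HiC : 0 < / C) by (apply Rinv_0_lt_compat, HC).
exists (2 * C); split; [lra|]; intros M.
destruct (Hcop M) as [x [Hx Hest]].
(* At most M weights, each at most the l^p norm, are affected by the truncation, so its error is at
   most C and at most 1/(2C) times that norm: C becomes 2C. *)
set (eta := Rmin C (/ (2 * C)) / INR (S M)).
assert (HM : 0 < INR (S M)) by (apply lt_0_INR; lia).
assert (Heta : 0 < eta).
{ apply Rdiv_lt_0_compat; [apply Rmin_glb_lt; [lra | apply Rinv_0_lt_compat; lra] | lra]. }
destruct (head_approximation x eta Hsep Hx Heta) as [r Hr].
set (u := slice 0 r x) in *.
assert (Hu : mem u) by apply mem_slice, Hx.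
exists u, r; split; [|intros i Hi; apply slice_out; lia].
split; [exact Hu|]; intros l Hl.
assert (H0 := lp_list_nonneg p l).
assert (Herr : sum_abs l * nrm (seq_sub x u) <= Rmin C (/ (2 * C)) * lp_list p l).
{ apply Rle_trans with (INR (S M) * lp_list p l * eta).
  - apply Rmult_le_compat; [| apply nrm_nonneg, mem_sub; auto | | lra].
    + clear; induction l as [|y l IH]; simpl; [lra|]; generalize (Rabs_pos y); lra.
    + apply Rle_trans with (1 := sum_abs_le_lp p l Hp).
      apply Rmult_le_compat_r; [exact H0|]; apply le_INR; lia.
  - right; unfold eta; field; lra. }
generalize (copies_nrm_perturb x u l Hx Hu) (copies_nrm_perturb u x l Hu Hx).
rewrite (nrm_sub_comm u x) by auto.
destruct (Hest l Hl) as [H1 H2].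
assert (Hm1 : Rmin C (/ (2 * C)) * lp_list p l <= C * lp_list p l)
  by (apply Rmult_le_compat_r; [exact H0 | apply Rmin_l]).
assert (Hm2 : Rmin C (/ (2 * C)) * lp_list p l <= / (2 * C) * lp_list p l)
  by (apply Rmult_le_compat_r; [exact H0 | apply Rmin_r]).
assert (E : / C * lp_list p l = 2 * (/ (2 * C) * lp_list p l)) by (field; lra).
intros H3 H4; split; lra.
Qed.

Lemma lp_copies_of_crude p : separable mem nrm -> Rbar_le (Finite 1) p ->
  crude_sym_fin_rep mem nrm p -> lp_copies p.
Proof.
intros Hsep Hp [C [HC Hcrude]].
apply (lp_copies_truncate p C Hsep Hp HC); intros M.
destruct (Hcrude (S M)) as [x [Hx Hest]].
exists (x O); split; [apply Hx; lia|]; intros l Hl.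
destruct (Hest (fun k => nth k l 0)) as [H1 H2].
rewrite (lin_comb_admissible M x l Hx ltac:(lia)), lp_norm_list, map_nth_seq,
  lp_list_app_zeros in H1, H2 by lia.
split; assumption.
Qed.

(** * From crude to sharp estimates, and blocks *)

(** Put n = [length a]. By [outer_zipf_sorted] the error comes from the first n entries of the
    vector on one side, and from the entries of index N to nN-1 on the other. Both groups have q-th
    power sum at most n, whatever N is. *)
Lemma copies_nrm_outer_zipf C q u a N :
  0 < C -> 1 <= q -> mem u -> (1 <= length a <= N)%nat -> powsum q a = 1 ->
  (forall l, (length l <= length a * N)%nat ->
     copies_nrm u l <= C * lp_list (Finite q) l) ->
  Rabs (copies_nrm u (outer a (zipf_list q 0 N)) - copies_nrm u (zipf_list q 0 N))
    <= C * INR (length a).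
Proof.
intros HC Hq Hu [Hn HN] Ha Hest.
set (n := length a) in *.
assert (Hn1 : 1 <= INR n) by (apply (le_INR 1), Hn).
assert (Hroot : forall x, 0 <= x <= INR n -> C * rpow x (1 / q) <= C * INR n).
{ intros x Hx; apply Rmult_le_compat_l; [lra|].
  apply Rle_trans with (2 := rpow_root_le (INR n) q Hq Hn1).
  apply rpow_le; [apply Rlt_le, Rdiv_lt_0_compat; lra | exact Hx]. }
destruct (outer_zipf_sorted q a N Hq Ha) as [l [Hp [Hl0 [Hup Hlow]]]]; fold n in Hup, Hlow.
assert (Hlen : length l = (n * N)%nat).
{ rewrite <- (Permutation_length Hp), outer_length, length_map, zipf_list_length.
  reflexivity. }
replace (copies_nrm u (outer a (zipf_list q 0 N))) with (copies_nrm u l).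
2: { rewrite <- (copies_nrm_perm u _ _ Hu Hp).
  assert (HE : forall j, Rabs (nth j (outer (map Rabs a) (zipf_list q 0 N)) 0) =
      Rabs (nth j (outer a (zipf_list q 0 N)) 0)).
  { intros j; set (v := zipf_list q 0 N).
    assert (Hv : length v = N) by apply zipf_list_length.
    rewrite (Nat.div_mod_eq j (length v)), (Nat.mul_comm (length v)).
    rewrite !nth_outer by (apply Nat.mod_upper_bound; lia).
    rewrite <- Rabs_R0 at 1; rewrite map_nth, !Rabs_mult, Rabs_Rabsolu; reflexivity. }
  apply Rle_antisym; apply copies_nrm_le; auto; intros j; rewrite HE; lra. }
apply Rabs_le; split.
- apply Rle_trans with (- copies_nrm u (zipf_list q 0 n)).
  + apply Ropp_le_contravar; eapply Rle_trans.
    * apply Hest; rewrite zipf_list_length; nia.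
    * apply Hroot; split; [apply powsum_nonneg|].
      apply Rle_trans with (1 := powsum_zipf_le q 0 n Hq); simpl; lra.
  + assert (H1 : copies_nrm u (zipf_list q n (N - n)) <= copies_nrm u l).
    { apply copies_nrm_le; [exact Hu|]; intros k.
      destruct (Nat.lt_ge_cases k (N - n)) as [Hk|Hk].
      - rewrite nth_zipf_list by exact Hk.
        rewrite !Rabs_right; [apply Hlow; nia | apply Rle_ge, Hl0 |
          apply Rle_ge, Rlt_le, zipf_pos].
      - rewrite nth_overflow by (rewrite zipf_list_length; exact Hk).
        rewrite Rabs_R0; apply Rabs_pos. }
    assert (H2 := copies_nrm_app_le u (zipf_list q 0 n) (zipf_list q n (N - n)) Hu).
    replace (zipf_list q 0 n ++ zipf_list q n (N - n)) with (zipf_list q 0 N) in H2; [lra|].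
    replace N with (n + (N - n))%nat at 1 by lia; apply zipf_list_app.
- assert (H1 : copies_nrm u l <= copies_nrm u (zipf_list q 0 (n * N))).
  { apply copies_nrm_le; [exact Hu|]; intros k.
    destruct (Nat.lt_ge_cases k (n * N)) as [Hk|Hk].
    - rewrite nth_zipf_list by exact Hk.
      rewrite !Rabs_right; [apply Hup; lia | | apply Rle_ge, Hl0].
      apply Rle_ge, Rlt_le, zipf_pos.
    - rewrite nth_overflow by lia; rewrite Rabs_R0; apply Rabs_pos. }
  replace (n * N)%nat with (N + (n - 1) * N)%nat in H1 by nia.
  rewrite zipf_list_app in H1.
  assert (H2 := copies_nrm_app_le u (zipf_list q 0 N)
    (zipf_list q (0 + N) ((n - 1) * N)) Hu).
  enough (copies_nrm u (zipf_list q (0 + N) ((n - 1) * N)) <= C * INR n) by lra.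
  eapply Rle_trans; [apply Hest; rewrite zipf_list_length; nia|].
  apply Hroot; split; [apply powsum_nonneg|].
  apply Rle_trans with (1 := powsum_zipf_le q (0 + N) _ Hq).
  assert (HSN : 0 < INR (S (0 + N))) by (apply lt_0_INR; lia).
  apply Rmult_le_reg_r with (INR (S (0 + N))); [exact HSN|].
  unfold Rdiv; rewrite Rmult_assoc, Rinv_l, Rmult_1_r by lra.
  rewrite <- mult_INR; apply le_INR; nia.
Qed.

Lemma sharp_bounds eps t : 0 < eps -> Rabs (t - 1) <= eps / (1 + eps) ->
  / (1 + eps) <= t <= 1 + eps.
Proof.
intros He Ht; apply Rabs_le_between in Ht.
assert (E : eps / (1 + eps) = 1 - / (1 + eps)) by (field; lra).
assert (H : eps / (1 + eps) <= eps).
{ apply Rmult_le_reg_r with (1 + eps); [lra|]; field_simplify; nra. }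
lra.
Qed.

(** One block of (a) will be the copies of [u] weighted by [v]; the finite support and [v <> nil]
    allow it to be laid out on a nonempty interval. *)
Definition sharp_copies (p : Rbar) : Prop :=
  forall n eps, (1 <= n)%nat -> 0 < eps -> exists u r v,
    mem u /\ (forall i, (r <= i)%nat -> u i = 0) /\ v <> nil /\
    forall a, length a = n ->
      / (1 + eps) * lp_list p a <= copies_nrm u (outer a v) /\
      copies_nrm u (outer a v) <= (1 + eps) * lp_list p a.

Lemma sharp_copies_finite q : 1 <= q -> lp_copies (Finite q) -> sharp_copies (Finite q).
Proof.
intros Hq [C [HC Hcop]] n eps Hn Heps.
set (e := eps / (1 + eps)).
assert (He : 0 < e) by (apply Rdiv_lt_0_compat; lra).
assert (HnR : 0 < INR n) by (apply lt_0_INR; lia).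
(* Once the norm phi of the extremal vector is at least K, the absolute error C n is at most e phi.
   For phi >= K it suffices that the vector has l^q norm at least C K, whence the bound passed to
   [powsum_zipf_unbounded]. *)
set (K := C * INR n / e).
assert (HK : 0 < K) by (apply Rdiv_lt_0_compat; [apply Rmult_lt_0_compat|]; lra).
destruct (powsum_zipf_unbounded q (rpow (C * K) q) Hq) as [N0 HN0].
set (N := Nat.max N0 n).
destruct (Hcop (n * N)%nat) as [u [r [[Hu Hest] Hr]]].
set (phi := copies_nrm u (zipf_list q 0 N)).
assert (Hphi : K <= phi).
{ apply Rle_trans with (/ C * lp_list (Finite q) (zipf_list q 0 N)).
  - apply Rmult_le_reg_l with C; [exact HC|].
    rewrite <- Rmult_assoc, Rinv_r, Rmult_1_l by lra.
    assert (HCK : 0 <= C * K) by (apply Rmult_le_pos; lra).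
    rewrite <- (rpow_rpow (C * K) q (1 / q)) by (exact HCK || (field; lra)).
    apply rpow_le; [apply Rlt_le, Rdiv_lt_0_compat; lra|].
    split; [apply rpow_nonneg | apply HN0; lia].
  - apply Hest; rewrite zipf_list_length; nia. }
exists u, r, (map (Rmult (/ phi)) (zipf_list q 0 N)).
split; [exact Hu|]; split; [exact Hr|]; split.
{ intros E; apply (f_equal (@length R)) in E.
  rewrite length_map, zipf_list_length in E; simpl in E; lia. }
intros a Ha.
rewrite outer_scal_r, copies_nrm_scal by exact Hu.
set (s := lp_list (Finite q) a).
assert (Hs : 0 <= s) by apply lp_list_nonneg.
destruct (Req_dec s 0) as [Hs0|Hs0].
- rewrite <- (map_scal_0 a), outer_scal_l, copies_nrm_scal, Rabs_R0, Hs0; [lra | exact Hu |].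
  intros x Hx; assert (H := lp_list_In (Finite q) a x Hq Hx); fold s in H.
  apply Rabs_eq_0; generalize (Rabs_pos x); lra.
- set (b := map (Rmult (/ s)) a).
  assert (Hb : powsum q b = 1).
  { rewrite <- (rpow_1_l q), <- (rpow_rpow (powsum q b) (1 / q) q)
      by (apply powsum_nonneg || (field; lra)).
    f_equal; change (lp_list (Finite q) b = 1); unfold b.
    rewrite lp_list_scal by exact Hq; fold s.
    rewrite Rabs_right by (apply Rle_ge, Rlt_le, Rinv_0_lt_compat; lra); field; lra. }
  assert (Hlb : length b = n) by (unfold b; rewrite length_map; exact Ha).
  rewrite <- (map_scal_inv s a Hs0); fold b.
  rewrite outer_scal_l, copies_nrm_scal by exact Hu.
  assert (Hd := copies_nrm_outer_zipf C q u b N HC Hq Hu ltac:(lia) Hb).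
  rewrite Hlb in Hd; specialize (Hd (fun l Hl => proj2 (Hest l Hl))); fold phi in Hd.
  set (psi := copies_nrm u (outer b (zipf_list q 0 N))) in *.
  rewrite (Rabs_right s) by lra.
  rewrite (Rabs_right (/ phi)) by (apply Rle_ge, Rlt_le, Rinv_0_lt_compat; lra).
  assert (Ht : Rabs (/ phi * psi - 1) <= e).
  { replace (/ phi * psi - 1) with (/ phi * (psi - phi)) by (field; lra).
    rewrite Rabs_mult, Rabs_right by (apply Rle_ge, Rlt_le, Rinv_0_lt_compat; lra).
    apply Rmult_le_reg_l with phi; [lra|].
    rewrite <- Rmult_assoc, Rinv_r, Rmult_1_l by lra.
    apply Rle_trans with (1 := Hd).
    apply Rle_trans with (K * e); [right; unfold K; field; lra|].
    apply Rmult_le_compat_r; lra. }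
  destruct (sharp_bounds eps _ Heps Ht) as [H1 H2].
  replace (/ phi * (s * psi)) with (/ phi * psi * s) by ring.
  split; apply Rmult_le_compat_r; assumption.
Qed.

(* James's argument: the norms of [n^j] equal copies are bounded in [j], hence
   grow by a factor at most [1 + eps] at some step. *)
Lemma sharp_copies_infty : lp_copies p_infty -> sharp_copies p_infty.
Proof.
intros [C [HC Hcop]] n eps Hn Heps.
(* All phi j with j <= J lie between 1/C and C; J steps of growth above 1+eps would exceed the ratio
   C^2. *)
destruct (Pow_x_infinity (1 + eps) ltac:(rewrite Rabs_right; lra) (C * C + 1))
  as [J HJ].
specialize (HJ J (Nat.le_refl _)).
rewrite Rabs_right in HJ by (apply Rle_ge, pow_le; lra).
destruct (Hcop (n ^ J)%nat) as [u [r [[Hu Hest] Hr]]].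
set (phi := fun j => copies_nrm u (repeat 1 (n ^ j))).
assert (HnJ : forall j, (1 <= n ^ j)%nat)
  by (intros j; generalize (Nat.pow_nonzero n j); lia).
assert (Hmax : forall m, (1 <= m)%nat -> maxabs (repeat 1 m) = 1).
{ intros m Hm; apply Rle_antisym.
  - apply maxabs_le; [lra|]; intros x Hx; apply repeat_spec in Hx; subst.
    rewrite Rabs_R1; lra.
  - rewrite <- Rabs_R1 at 1; apply maxabs_In; destruct m; [lia | left; reflexivity]. }
assert (Hphi : forall j, (j <= J)%nat -> / C <= phi j <= C).
{ intros j Hj.
  destruct (Hest (repeat 1 (n ^ j))) as [H1 H2].
  - rewrite repeat_length; apply Nat.pow_le_mono_r; lia.
  - cbn [lp_list] in H1, H2; rewrite Hmax in H1, H2 by apply HnJ.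
    unfold phi; lra. }
assert (HiC : 0 < / C) by (apply Rinv_0_lt_compat, HC).
assert (Hex : exists j, (j < J)%nat /\ phi (S j) <= (1 + eps) * phi j).
{ apply NNPP; intros Hn0.
  assert (H : forall j, (j <= J)%nat -> (1 + eps) ^ j * / C <= phi j).
  { induction j as [|j IH]; intros Hj; [simpl; generalize (Hphi 0%nat Hj); lra|].
    apply Rle_trans with ((1 + eps) * phi j).
    - simpl; rewrite Rmult_assoc; apply Rmult_le_compat_l; [lra|]; apply IH; lia.
    - apply Rlt_le, Rnot_le_lt; intros Hle; apply Hn0; exists j; auto. }
  specialize (H J (Nat.le_refl _)); generalize (Hphi J (Nat.le_refl _)); intros [_ H2].
  assert (H3 : (1 + eps) ^ J <= C * C).
  { apply Rmult_le_reg_r with (/ C); [exact HiC|].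
    replace (C * C * / C) with C by (field; lra); lra. }
  lra. }
destruct Hex as [j [Hj Hstep]].
assert (Hpos : 0 < phi j) by (generalize (Hphi j ltac:(lia)); lra).
exists u, r, (repeat (/ phi j) (n ^ j)).
split; [exact Hu|]; split; [exact Hr|]; split.
{ intros E; apply (f_equal (@length R)) in E; rewrite repeat_length in E.
  specialize (HnJ j); simpl in E; lia. }
replace (repeat (/ phi j) (n ^ j)) with (map (Rmult (/ phi j)) (repeat 1 (n ^ j)))
  by (rewrite map_repeat, Rmult_1_r; reflexivity).
intros a Ha; cbn [lp_list].
assert (Hm := maxabs_nonneg a).
rewrite outer_scal_r, copies_nrm_scal by exact Hu.
rewrite Rabs_right by (apply Rle_ge, Rlt_le, Rinv_0_lt_compat, Hpos).
assert (Hscale : forall x y, 0 < x -> x * phi j <= y -> x <= / phi j * y).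
{ intros x y Hx H; apply Rmult_le_reg_l with (phi j); [exact Hpos|].
  rewrite <- Rmult_assoc, Rinv_r, Rmult_1_l; lra. }
split.
- apply Rle_trans with (maxabs a).
  { rewrite <- (Rmult_1_l (maxabs a)) at 2; apply Rmult_le_compat_r; [exact Hm|].
    rewrite <- Rinv_1; apply Rinv_le_contravar; lra. }
  (* The row of a largest entry alone already has norm [maxabs a] after division by phi j. *)
  destruct (maxabs_attained a) as [x [Hx Hxm]]; [intros ->; simpl in Ha; lia|].
  apply Rmult_le_reg_l with (phi j); [exact Hpos|].
  rewrite <- Rmult_assoc, Rinv_r, Rmult_1_l, Rmult_comm, <- Hxm by lra.
  apply in_split in Hx; destruct Hx as [a1 [a2 ->]].
  unfold phi; rewrite <- copies_nrm_scal by exact Hu.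
  unfold outer; rewrite flat_map_app; cbn [flat_map].
  eapply Rle_trans; [apply copies_nrm_app_l, Hu | apply copies_nrm_app_r, Hu].
(* All n rows together are dominated by n^(j+1) copies weighted [maxabs a], and phi (j+1) <= (1+eps)
   phi j. *)
- apply Rle_trans with (/ phi j * (maxabs a * phi (S j))).
  + apply Rmult_le_compat_l; [apply Rlt_le, Rinv_0_lt_compat, Hpos|].
    rewrite <- (Rabs_right (maxabs a)) by lra.
    unfold phi; rewrite <- copies_nrm_scal by exact Hu.
    apply copies_nrm_le; [exact Hu|]; intros k.
    assert (Hlen : length (outer a (repeat 1 (n ^ j))) = (n ^ S j)%nat)
      by (rewrite outer_length, repeat_length, Ha; reflexivity).
    destruct (Nat.lt_ge_cases k (n ^ S j)) as [Hk|Hk].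
    * rewrite map_repeat, Rmult_1_r, (nth_repeat_lt _ 0) by exact Hk.
      rewrite (Rabs_right (maxabs a)) by lra.
      set (y := nth k _ 0).
      assert (Hy : In y (outer a (repeat 1 (n ^ j)))) by (apply nth_In; lia).
      unfold outer in Hy; apply in_flat_map in Hy; destruct Hy as [x [Hx Hy]].
      rewrite map_repeat in Hy; apply repeat_spec in Hy.
      rewrite Hy, Rmult_1_r; apply maxabs_In, Hx.
    * rewrite nth_overflow by lia; rewrite Rabs_R0; apply Rabs_pos.
  + replace (/ phi j * (maxabs a * phi (S j)))
      with (/ phi j * phi (S j) * maxabs a) by ring.
    apply Rmult_le_compat_r; [exact Hm|].
    apply Rmult_le_reg_l with (phi j); [exact Hpos|].
    rewrite <- Rmult_assoc, Rinv_r, Rmult_1_l; lra.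
Qed.

(** With support in [0, r), copy k fits in the interval [k r, (k+1) r); this replaces the Cantor
    layout by a linear one. *)
Lemma flatten_copies u r l : mem u -> (1 <= r)%nat ->
  (forall i, (r <= i)%nat -> u i = 0) ->
  let z := fun j => nth (j / r) l 0 * u (j mod r)%nat in
  mem z /\ nrm z = copies_nrm u l.
Proof.
intros Hu Hr Hfin z.
assert (Hle : mem z /\ nrm z <= copies_nrm u l).
{ apply (domination (fun j m => m = to_nat (j / r, j mod r)%nat) (copies u l)).
  - apply mem_copies, Hu.
  - intros j _; eexists; split; [reflexivity|].
    unfold copies; rewrite arr_to_nat; unfold z; lra.
  - intros j j' m _ _ -> E; apply to_nat_pair_inj in E; destruct E as [E1 E2].
    rewrite (Nat.div_mod_eq j r), (Nat.div_mod_eq j' r), E1, E2; reflexivity. }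
split; [apply Hle|]; apply Rle_antisym; [apply Hle|].
assert (Hlt : forall j, copies u l j <> 0 -> (snd (of_nat j) < r)%nat).
{ intros j Hj; apply Nat.nle_gt; intros H; apply Hj; unfold copies, arr.
  rewrite Hfin by exact H; ring. }
apply (domination (fun j m => m = fst (of_nat j) * r + snd (of_nat j))%nat z
  (copies u l) (proj1 Hle)).
- intros j Hj; eexists; split; [reflexivity|].
  specialize (Hlt j Hj); unfold z.
  rewrite Nat.div_add_l, Nat.div_small, Nat.add_0_r by lia.
  rewrite Nat.add_comm, Nat.Div0.mod_add, Nat.mod_small by exact Hlt.
  unfold copies, arr; lra.
- intros j j' m Hj Hj' -> E.
  assert (H1 := Hlt j Hj); assert (H2 := Hlt j' Hj').
  assert (E1 : fst (of_nat j) = fst (of_nat j')) by nia.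
  apply nat_pair_eq; [exact E1|]; rewrite E1 in E; lia.
Qed.

(** * Realization by consecutive blocks *)

Lemma block_in m alpha k j : (m k <= j < m (S k))%nat -> block m alpha k j = alpha j.
Proof. exact (slice_in (m k) (m (S k)) alpha j). Qed.

Lemma block_out m alpha k j : ~ (m k <= j < m (S k))%nat -> block m alpha k j = 0.
Proof. exact (slice_out (m k) (m (S k)) alpha j). Qed.

Lemma sym_block_fin_rep_of_sharp p : Rbar_le (Finite 1) p ->
  sharp_copies p -> sym_block_fin_rep mem nrm p.
Proof.
intros Hp Hsharp n eps Heps.
destruct n as [|n0].
{ exists (fun k => k), (fun _ => 0).
  split; [reflexivity|]; do 3 (split; [intros; lia|]).
  intros a; change (lin_comb 0 a (block (fun k => k) (fun _ => 0))) with seq0.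
  rewrite nrm_seq0; change (lp_norm p 0 a) with (lp_norm p 0 (fun _ => 0)).
  rewrite lp_norm_list; change (map _ (seq 0 0)) with (map (Rmult 0) nil).
  rewrite lp_list_scal, Rabs_R0 by exact Hp; lra. }
set (n := S n0) in *.
destruct (Hsharp n eps ltac:(lia) Heps) as [u [r0 [v [Hu [Hfin [Hv Hest]]]]]].
set (r := S r0).
assert (Hfin' : forall i, (r <= i)%nat -> u i = 0) by (intros i Hi; apply Hfin; lia).
set (N := length v).
assert (HN : (1 <= N)%nat) by (unfold N; destruct v; [congruence | simpl; lia]).
set (L := (N * r)%nat).
assert (HL : (1 <= L)%nat) by (unfold L, r; nia).
(* Periodic with period L, so all blocks have literally the same list of coefficients and the
   permutation between them is the identity. *)
set (alpha := fun j => nth ((j / r) mod N) v 0 * u (j mod r)%nat).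
set (m := fun k => (k * L)%nat).
assert (Hcomb : forall a j, lin_comb n a (block m alpha) j =
  nth (j / r) (outer (map a (seq 0 n)) v) 0 * u (j mod r)%nat).
{ intros a j; unfold lin_comb.
  assert (Hq : (j / L = (j / r) / N)%nat)
    by (unfold L; rewrite Nat.mul_comm, Nat.Div0.div_div; reflexivity).
  assert (HjL := Nat.div_mod_eq j L).
  assert (HjL' := Nat.mod_upper_bound j L ltac:(lia)).
  destruct (Nat.lt_ge_cases (j / L) n) as [Hk|Hk].
  - rewrite (fsum_single n _ (j / L)%nat Hk).
    + rewrite block_in by (unfold m; nia).
      rewrite (Nat.div_mod_eq (j / r) N), (Nat.mul_comm N), <- Hq; unfold N at 1.
      rewrite nth_outer by (apply Nat.mod_upper_bound; fold N; lia).
      rewrite (nth_indep _ 0 (a O)) by (rewrite length_map, length_seq; exact Hk).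
      rewrite map_nth, seq_nth by exact Hk; unfold alpha; fold N.
      rewrite Nat.add_0_l; ring.
    + intros i Hi Hij; rewrite block_out; [ring|]; unfold m; nia.
  - rewrite fsum_zero.
    + rewrite nth_overflow; [ring|].
      rewrite outer_length, length_map, length_seq; fold N.
      assert (H := Nat.div_mod_eq (j / r) N); rewrite <- Hq in H; nia.
    + intros i Hi; rewrite block_out; [ring|]; unfold m; nia. }
exists m, alpha.
split; [reflexivity|]; split; [intros k _; unfold m; nia|]; split; [|split].
- intros k Hk.
  (* A single block is dominated by the sum of all blocks, which is a flattened family of copies. *)
  destruct (flatten_copies u r (outer (map (fun _ => 1) (seq 0 n)) v) Hu ltac:(lia) Hfin')
    as [Hz _].
  apply (mem_lattice _ _ Hz); intros j.
  rewrite <- (Hcomb (fun _ => 1)).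
  destruct (classic (m k <= j < m (S k))%nat) as [Hj|Hj].
  + unfold lin_comb; rewrite (fsum_single n _ k Hk); [rewrite Rmult_1_l; lra|].
    intros i Hi Hik; rewrite block_out; [ring|]; unfold m in *; nia.
  + rewrite block_out, Rabs_R0 by exact Hj; apply Rabs_pos.
- intros k l _ _.
  assert (Hlen : forall i, (m (S i) - m i = L)%nat) by (intros i; unfold m; nia).
  split; [rewrite !Hlen; reflexivity|].
  assert (Hper : forall i len s, map alpha (seq (m i + s) len) = map alpha (seq s len)).
  { intros i len; induction len as [|len IH]; intros s; [reflexivity|]; simpl.
    rewrite plus_n_Sm, IH; f_equal; unfold alpha, m, L.
    replace (i * (N * r) + s)%nat with (s + i * N * r)%nat by ring.
    rewrite Nat.div_add, !Nat.Div0.mod_add by (unfold r; lia); reflexivity. }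
  unfold block_coeffs; rewrite !Hlen, <- (Nat.add_0_r (m k)), <- (Nat.add_0_r (m l)).
  rewrite !Hper; apply Permutation_refl.
- intros a.
  replace (lin_comb n a (block m alpha)) with
    (fun j => nth (j / r) (outer (map a (seq 0 n)) v) 0 * u (j mod r)%nat)
    by (apply functional_extensionality; intros j; symmetry; apply Hcomb).
  rewrite (proj2 (flatten_copies u r _ Hu ltac:(lia) Hfin')), lp_norm_list.
  apply Hest; rewrite length_map, length_seq; reflexivity.
Qed.

Lemma Permutation_bijection (l l' : list R) : Permutation l l' ->
  exists f g : nat -> nat, forall i, (i < length l)%nat ->
    (f i < length l)%nat /\ (g i < length l)%nat /\ g (f i) = i /\ f (g i) = i /\
    nth (f i) l' 0 = nth i l 0.
Proof.
intros Hp; apply Permutation_sym in Hp.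
assert (Hlen := Permutation_length Hp).
apply (Permutation_nth l' l 0) in Hp; destruct Hp as [_ [f [Hf [Hinj Hnth]]]].
destruct (bSurjective_bBijective Hf) as [g [Hg Hfg]].
{ apply bInjective_bSurjective; assumption. }
exists f, g; intros i Hi; rewrite <- Hlen in *.
repeat split; [apply Hf | apply Hg | apply Hfg | apply Hfg |]; auto.
symmetry; apply Hnth; exact Hi.
Qed.

(** A permutation of all of nat is required: it exchanges the two intervals through f and its
    inverse g and fixes everything else, so it is an involution. Off its own interval each block is
    0, so the exchanged zeros match as well. *)
Lemma blocks_same_ordered_distr m alpha k l : (m (S k) <= m l)%nat ->
  (m (S k) - m k = m (S l) - m l)%nat -> (m k < m (S k))%nat ->
  Permutation (block_coeffs m alpha k) (block_coeffs m alpha l) ->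
  same_ordered_distr (block m alpha k) (block m alpha l).
Proof.
intros Hkl Hlen Hlt Hp.
assert (Hnth : forall i j, (j < m (S k) - m k)%nat ->
  (m (S i) - m i = m (S k) - m k)%nat -> nth j (block_coeffs m alpha i) 0 = alpha (m i + j)%nat).
{ intros i j Hj Hi; unfold block_coeffs.
  rewrite (nth_indep _ 0 (alpha O)) by (rewrite length_map, length_seq; lia).
  rewrite map_nth, seq_nth by lia; reflexivity. }
destruct (Permutation_bijection _ _ Hp) as [f [g Hfg]].
unfold block_coeffs at 1 2 3 in Hfg; rewrite length_map, length_seq in Hfg.
set (d := (m (S k) - m k)%nat) in *.
set (swap := fun (f g : nat -> nat) j =>
  if andb (Nat.leb (m k) j) (Nat.ltb j (m (S k))) then (m l + f (j - m k))%nat else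
  if andb (Nat.leb (m l) j) (Nat.ltb j (m (S l))) then (m k + g (j - m l))%nat else j).
assert (Hcases : forall j, (exists i, (i < d)%nat /\ j = (m k + i)%nat) \/
  (exists i, (i < d)%nat /\ j = (m l + i)%nat) \/
  ~ (m k <= j < m (S k))%nat /\ ~ (m l <= j < m (S l))%nat).
{ intros j; destruct (classic (m k <= j < m (S k))%nat);
    [left; exists (j - m k)%nat; lia|].
  destruct (classic (m l <= j < m (S l))%nat);
    [right; left; exists (j - m l)%nat; lia | auto]. }
assert (Hk : forall f g i, (i < d)%nat -> swap f g (m k + i)%nat = (m l + f i)%nat).
{ intros f' g' i Hi; unfold swap.
  destruct (Nat.leb_spec (m k) (m k + i)); [|lia].
  destruct (Nat.ltb_spec (m k + i) (m (S k))); [|lia]; simpl.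
  do 2 f_equal; lia. }
assert (Hl : forall f g i, (i < d)%nat -> swap f g (m l + i)%nat = (m k + g i)%nat).
{ intros f' g' i Hi; unfold swap.
  destruct (Nat.ltb_spec (m l + i) (m (S k))); [lia|]; rewrite Bool.andb_false_r.
  destruct (Nat.leb_spec (m l) (m l + i)); [|lia].
  destruct (Nat.ltb_spec (m l + i) (m (S l))); [|lia]; simpl.
  do 2 f_equal; lia. }
assert (Ho : forall f g j, ~ (m k <= j < m (S k))%nat -> ~ (m l <= j < m (S l))%nat ->
  swap f g j = j).
{ intros f' g' j H1 H2; unfold swap.
  destruct (Nat.leb_spec (m k) j), (Nat.ltb_spec j (m (S k))),
    (Nat.leb_spec (m l) j), (Nat.ltb_spec j (m (S l))); reflexivity || lia. }
exists (swap f g), (swap f g).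
assert (Hinv : forall j, swap f g (swap f g j) = j).
{ intros j; destruct (Hcases j) as [[i [Hi ->]]|[[i [Hi ->]]|[H1 H2]]].
  - destruct (Hfg i Hi) as [H1 [_ [H2 _]]]; rewrite Hk, Hl, H2 by assumption; reflexivity.
  - destruct (Hfg i Hi) as [_ [H1 [_ [H2 _]]]].
    rewrite Hl, Hk, H2 by assumption; reflexivity.
  - rewrite !(Ho f g j) by assumption; reflexivity. }
split; [exact Hinv|]; split; [exact Hinv|].
intros j; destruct (Hcases j) as [[i [Hi ->]]|[[i [Hi ->]]|[H1 H2]]].
- destruct (Hfg i Hi) as [H1 [_ [_ [_ H2]]]].
  rewrite Hk, !block_in by lia.
  rewrite <- !Hnth by lia; exact H2.
- destruct (Hfg i Hi) as [_ [H1 _]].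
  rewrite Hl, !block_out by lia; reflexivity.
- rewrite Ho, !block_out by assumption; reflexivity.
Qed.

Lemma same_ordered_distr_sym x y : same_ordered_distr x y -> same_ordered_distr y x.
Proof.
intros [f [g [H1 [H2 H3]]]]; exists g, f; repeat split; auto.
intros k; rewrite <- (H2 k) at 2; symmetry; apply H3.
Qed.

Lemma sym_fin_rep_of_block p : sym_block_fin_rep mem nrm p -> sym_fin_rep mem nrm p.
Proof.
intros H n eps Heps.
destruct (H n eps Heps) as [m [alpha [_ [Hinc [Hmem [Hperm Hest]]]]]].
exists (block m alpha); split; [|exact Hest].
assert (Hmono : forall k l, (k < l)%nat -> (l < n)%nat -> (m (S k) <= m l)%nat).
{ intros k l Hkl; induction Hkl as [|l Hkl IH]; intros Hl; [lia|].
  specialize (IH ltac:(lia)); specialize (Hinc l ltac:(lia)); lia. }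
assert (Hlt : forall k l, (k < l)%nat -> (l < n)%nat ->
  same_ordered_distr (block m alpha k) (block m alpha l)).
{ intros k l Hkl Hl; destruct (Hperm k l ltac:(lia) Hl) as [H1 H2].
  apply blocks_same_ordered_distr; auto; apply Hinc; lia. }
split; [exact Hmem|]; split.
- intros k l j Hk Hl Hkl Hj.
  apply block_out; intros H1; apply Hj, block_out; intros H2.
  destruct (Nat.lt_gt_cases k l) as [Hc _]; destruct (Hc Hkl) as [Hlt'|Hlt'].
  + generalize (Hmono k l Hlt' Hl); lia.
  + generalize (Hmono l k Hlt' Hk); lia.
- intros k l Hk Hl; destruct (Nat.lt_trichotomy k l) as [Hkl|[->|Hkl]].
  + apply Hlt; assumption.
  + exists (fun i => i), (fun i => i); auto.
  + apply same_ordered_distr_sym, Hlt; assumption.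
Qed.

Lemma crude_of_sym_fin_rep p : sym_fin_rep mem nrm p -> crude_sym_fin_rep mem nrm p.
Proof.
intros H; exists (1 + 1); split; [lra|]; intros n; apply H; lra.
Qed.

(** * The approximate eigenvalue *)

(* Put the i-th coordinate of [u] at node [2 ^ s + i] (counting from 1) of the
   binary tree in which node [P] has children [2 P] and [2 P + 1], and copy it
   to the descendants of that node with a weight depending on the generation. *)
Definition tree (s : nat) (u : seqR) (c : nat -> R) : seqR :=
  fun j => if Nat.ltb (S j) (2 ^ s) then 0 else
    let l := (Nat.log2 (S j) - s)%nat in c l * u (S j / 2 ^ l - 2 ^ s)%nat.

(** The action of [Dop] on generation weights: a child takes the weight of its parent, and
    generation 0 gets 0 because its parents lie outside the tree. *)
Definition shift (c : nat -> R) (l : nat) : R := match l with O => 0 | S l' => c l' end.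

Lemma log2_ge s P : (2 ^ s <= P)%nat -> (s <= Nat.log2 P)%nat.
Proof.
intros H; apply Nat.log2_le_pow2; [|exact H].
generalize (Nat.pow_nonzero 2 s); lia.
Qed.

Lemma log2_half P : (2 <= P)%nat -> Nat.log2 P = S (Nat.log2 (P / 2)).
Proof.
intros HP; assert (H := Nat.div_mod_eq P 2).
assert (Hm := Nat.mod_upper_bound P 2 ltac:(lia)).
assert (Hh : (0 < P / 2)%nat) by lia.
destruct (P mod 2)%nat as [|[|m]]; [| |lia]; rewrite H at 1.
- rewrite Nat.add_0_r; apply Nat.log2_double, Hh.
- apply Nat.log2_succ_double, Hh.
Qed.

Lemma Dop_tree s u c : Dop (tree s u c) = tree s u (shift c).
Proof.
assert (Hs : (1 <= 2 ^ s)%nat) by (generalize (Nat.pow_nonzero 2 s); lia).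
apply functional_extensionality; intros [|j].
{ unfold Dop, tree; destruct (Nat.ltb_spec 1 (2 ^ s)); [reflexivity|]; simpl; ring. }
set (P := S (S j)).
assert (HP := Nat.div_mod_eq P 2).
assert (HPm := Nat.mod_upper_bound P 2 ltac:(lia)).
assert (HP2 : (2 <= P)%nat) by (unfold P; lia).
change (Dop (tree s u c) (S j)) with (tree s u c ((S j + 1) / 2 - 1)%nat).
unfold tree; fold P.
replace (S ((S j + 1) / 2 - 1)) with (P / 2)%nat
  by (replace (S j + 1)%nat with P by (unfold P; lia); lia).
destruct (Nat.ltb_spec P (2 ^ s)) as [H|H].
- destruct (Nat.ltb_spec (P / 2) (2 ^ s)); [reflexivity | lia].
- destruct (Nat.ltb_spec (P / 2) (2 ^ s)) as [H'|H'].
  (* Here 2^s <= P < 2^(s+1): P is a root, of generation 0. *)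
  + rewrite (Nat.log2_unique P s) by (simpl; lia).
    rewrite Nat.sub_diag; simpl; ring.
  (* A node and its parent have the same root: halving l+1 times is halving the parent l times. *)
  + assert (Hl := log2_ge s _ H').
    rewrite (log2_half P HP2), Nat.sub_succ_l by exact Hl.
    cbn [shift]; rewrite Nat.pow_succ_r', <- Nat.Div0.div_div; reflexivity.
Qed.

(** A root has 2^l descendants in generation l, hence 2^l copies weighted [c l]. The entry of index
    k belongs to node k+1 of a binary tree rooted at 1. *)
Fixpoint levels (c : nat -> R) (m : nat) : list R :=
  match m with O => nil | S m' => levels c m' ++ repeat (c m') (2 ^ m') end.

Lemma length_levels c m : S (length (levels c m)) = (2 ^ m)%nat.
Proof.
induction m as [|m IH]; [reflexivity|]; simpl.
rewrite length_app, repeat_length; lia.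
Qed.

Lemma nth_levels c m k : (S k < 2 ^ m)%nat ->
  nth k (levels c m) 0 = c (Nat.log2 (S k)).
Proof.
induction m as [|m IH]; intros Hk; [simpl in Hk; lia|]; simpl in Hk |- *.
assert (Hlen := length_levels c m).
destruct (Nat.lt_ge_cases (S k) (2 ^ m)) as [H|H].
- rewrite app_nth1 by lia; apply IH, H.
- rewrite app_nth2, (nth_repeat_lt _ 0) by lia.
  rewrite (Nat.log2_unique (S k) m) by (simpl; lia); reflexivity.
Qed.

Lemma levels_In c m x : In x (levels c m) <-> exists l, (l < m)%nat /\ x = c l.
Proof.
induction m as [|m IH]; simpl.
- split; [tauto | intros [l [Hl _]]; lia].
- rewrite in_app_iff, IH; split.
  + intros [[l [Hl E]]|H]; [exists l; split; [lia | exact E]|].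
    apply repeat_spec in H; exists m; auto.
  + intros [l [Hl ->]]; destruct (Nat.eq_dec l m) as [->|Hlm].
    * right; generalize (Nat.pow_nonzero 2 m); destruct (2 ^ m)%nat; [lia|].
      intros _; left; reflexivity.
    * left; exists l; split; [lia | reflexivity].
Qed.

(** A node P of generation l is uniquely 2^l Q + t with t < 2^l. The root Q = 2^s + i gives the
    coordinate i, and the path t names the copy, whose index in [levels] is 2^l + t - 1. The support
    bound keeps all roots below 2^(s+1). *)
Lemma tree_copies s u c m : mem u -> (forall i, (2 ^ s <= i)%nat -> u i = 0) ->
  (forall l, (m <= l)%nat -> c l = 0) ->
  mem (tree s u c) /\ nrm (tree s u c) = copies_nrm u (levels c m).
Proof.
intros Hu Hfin Hc.
assert (Hpow : forall l, (1 <= 2 ^ l)%nat)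
  by (intros l; generalize (Nat.pow_nonzero 2 l); lia).
assert (Hpow_le : forall l l', (l <= l')%nat -> (2 ^ l <= 2 ^ l')%nat)
  by (intros; apply Nat.pow_le_mono_r; lia).
set (gen := fun j => (Nat.log2 (S j) - s)%nat).
set (pos := fun j => (2 ^ gen j + S j mod 2 ^ gen j - 1)%nat).
assert (Hgen : forall j, tree s u c j <> 0 -> (2 ^ s <= S j / 2 ^ gen j)%nat /\
  (gen j < m)%nat /\ tree s u c j = c (gen j) * u (S j / 2 ^ gen j - 2 ^ s)%nat).
{ intros j; unfold tree; fold (gen j).
  destruct (Nat.ltb_spec (S j) (2 ^ s)) as [H|H]; [congruence|].
  cbv zeta; intros Hj; split; [|split; [|reflexivity]].
  - apply Nat.div_le_lower_bound; [apply Nat.pow_nonzero; lia|].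
    rewrite <- Nat.pow_add_r.
    replace (gen j + s)%nat with (Nat.log2 (S j))
      by (unfold gen; generalize (log2_ge s _ H); lia).
    apply Nat.log2_spec; lia.
  - apply Nat.nle_gt; intros Hl; apply Hj; rewrite Hc by exact Hl; ring. }
assert (Hpos : forall j, Nat.log2 (S (pos j)) = gen j).
{ intros j; apply Nat.log2_unique; [lia|].
  generalize (Nat.mod_upper_bound (S j) (2 ^ gen j) (Nat.pow_nonzero 2 _ ltac:(lia)))
    (Hpow (gen j)).
  unfold pos; simpl; lia. }
assert (Hle : mem (tree s u c) /\ nrm (tree s u c) <= copies_nrm u (levels c m)).
{ apply (domination (fun j k => k = to_nat (pos j, S j / 2 ^ gen j - 2 ^ s)%nat)
    (copies u (levels c m))).
  - apply mem_copies, Hu.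
  - intros j Hj; eexists; split; [reflexivity|].
    destruct (Hgen j Hj) as [H1 [H2 ->]].
    unfold copies; rewrite arr_to_nat, nth_levels, Hpos; [lra|].
    apply Nat.lt_le_trans with (2 ^ S (gen j))%nat; [|apply Hpow_le; lia].
    rewrite <- (Hpos j); apply Nat.log2_spec; lia.
  - intros j j' k Hj Hj' -> E; apply to_nat_pair_inj in E; destruct E as [E1 E2].
    assert (Eg : gen j = gen j') by (rewrite <- !Hpos, E1; reflexivity).
    destruct (Hgen j Hj) as [H1 _], (Hgen j' Hj') as [H1' _].
    unfold pos in E1; rewrite <- Eg in *.
    generalize (Nat.div_mod_eq (S j) (2 ^ gen j)) (Nat.div_mod_eq (S j') (2 ^ gen j))
      (Hpow (gen j)); intros D1 D2 D3.
    assert (E3 : (S j / 2 ^ gen j = S j' / 2 ^ gen j)%nat) by lia.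
    rewrite E3 in D1; lia. }
split; [apply Hle|]; apply Rle_antisym; [apply Hle|].
(* The inverse of ([pos], coordinate): k+1 = 2^l + t encodes both the generation l and the path
   t. *)
set (node := fun k i => let l := Nat.log2 (S k) in
  (2 ^ l * (2 ^ s + i) + (S k - 2 ^ l))%nat).
assert (Hnode : forall k i, (i < 2 ^ s)%nat ->
  (2 ^ s <= node k i)%nat /\ Nat.log2 (node k i) = (Nat.log2 (S k) + s)%nat /\
  (node k i / 2 ^ Nat.log2 (S k) = 2 ^ s + i)%nat /\
  (node k i mod 2 ^ Nat.log2 (S k) = S k - 2 ^ Nat.log2 (S k))%nat).
{ intros k i Hi; unfold node; cbv zeta; set (l := Nat.log2 (S k)).
  assert (Hlog := Nat.log2_spec (S k) ltac:(lia)); fold l in Hlog; simpl in Hlog.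
  assert (Hr : (S k - 2 ^ l < 2 ^ l)%nat) by lia.
  assert (Hl0 := Hpow l).
  split; [generalize (Hpow l); nia|]; split.
  - apply Nat.log2_unique; [lia|]; rewrite Nat.pow_succ_r', Nat.pow_add_r.
    generalize (Hpow l); nia.
  - rewrite (Nat.mul_comm (2 ^ l)); split.
    + rewrite Nat.div_add_l, Nat.div_small by lia; lia.
    + rewrite Nat.add_comm, Nat.Div0.mod_add; apply Nat.mod_small, Hr. }
assert (Hsupp : forall j, copies u (levels c m) j <> 0 ->
  (snd (of_nat j) < 2 ^ s)%nat /\ (S (fst (of_nat j)) < 2 ^ m)%nat).
{ intros j Hj; unfold copies, arr in Hj; split.
  - apply Nat.nle_gt; intros H; apply Hj; rewrite Hfin by exact H; ring.
  - rewrite <- (length_levels c m); apply -> Nat.succ_lt_mono.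
    apply nth_nonzero_lt; intros E; apply Hj; rewrite E; ring. }
apply (domination (fun j k => S k = node (fst (of_nat j)) (snd (of_nat j)))
  (tree s u c) (copies u (levels c m)) (proj1 Hle)).
- intros j Hj; destruct (Hsupp j Hj) as [H1 H2].
  destruct (Hnode (fst (of_nat j)) _ H1) as [N1 [N2 [N3 _]]].
  exists (pred (node (fst (of_nat j)) (snd (of_nat j)))).
  assert (HS : S (pred (node (fst (of_nat j)) (snd (of_nat j)))) =
    node (fst (of_nat j)) (snd (of_nat j))) by (generalize (Hpow s); lia).
  split; [exact HS|].
  unfold tree; rewrite HS.
  destruct (Nat.ltb_spec (node (fst (of_nat j)) (snd (of_nat j))) (2 ^ s)); [lia|].
  cbv zeta; rewrite N2, Nat.add_sub, N3.
  replace (2 ^ s + snd (of_nat j) - 2 ^ s)%nat with (snd (of_nat j)) by lia.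
  unfold copies, arr; rewrite nth_levels by exact H2; lra.
- intros j j' k Hj Hj' E E'; rewrite E in E'.
  destruct (Hsupp j Hj) as [H1 _], (Hsupp j' Hj') as [H1' _].
  destruct (Hnode (fst (of_nat j)) _ H1) as [_ [N2 [N3 N4]]].
  destruct (Hnode (fst (of_nat j')) _ H1') as [_ [N2' [N3' N4']]].
  rewrite <- E' in N2', N3', N4'.
  assert (El : Nat.log2 (S (fst (of_nat j))) = Nat.log2 (S (fst (of_nat j')))) by lia.
  rewrite <- El in N3', N4'.
  assert (B := Nat.log2_spec (S (fst (of_nat j))) ltac:(lia)).
  assert (B' := Nat.log2_spec (S (fst (of_nat j'))) ltac:(lia)).
  rewrite <- El in B'.
  apply nat_pair_eq; lia.
Qed.

Lemma two_pow_inv_bounds p : Rbar_le (Finite 1) p -> 1 <= two_pow_inv p <= 2.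
Proof.
intros Hp; destruct p as [q| |]; simpl in *; [|lra | tauto].
assert (Hq : 0 < 1 / q <= 1).
{ split; [apply Rdiv_lt_0_compat; lra|].
  apply Rmult_le_reg_r with q; [lra|]; field_simplify; lra. }
split.
- apply Rle_trans with (Rpower 2 0); [rewrite Rpower_O | apply Rle_Rpower]; lra.
- apply Rle_trans with (Rpower 2 1); [apply Rle_Rpower | rewrite Rpower_1]; lra.
Qed.

Lemma rpow_two_pow_inv q l : 1 <= q ->
  rpow (two_pow_inv (Finite q) ^ l) q = 2 ^ l.
Proof.
intros Hq; simpl two_pow_inv.
rewrite rpow_pos_eq by apply pow_lt, Rpower_pos.
rewrite <- Rpower_pow by apply Rpower_pos; rewrite !Rpower_mult.
rewrite <- Rpower_pow by lra; f_equal; field; lra.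
Qed.

(** The 2^l equal weights of generation l cancel the factor lam^(-l q) = 2^(-l), so the generations
    count equally. *)
Lemma powsum_levels q t m : 1 <= q ->
  powsum q (levels (fun l => (/ two_pow_inv (Finite q)) ^ l * t l) m) =
  fsum m (fun l => rpow (Rabs (t l)) q).
Proof.
intros Hq; set (lam := two_pow_inv (Finite q)).
assert (Hlam : 0 < lam) by (generalize (two_pow_inv_bounds (Finite q) Hq); fold lam; lra).
induction m as [|m IH]; [reflexivity|]; cbn [levels fsum].
rewrite powsum_app, IH, powsum_repeat, Rabs_mult, rpow_mult by apply Rabs_pos.
rewrite Rabs_right by (apply Rle_ge, pow_le, Rlt_le, Rinv_0_lt_compat, Hlam).
enough (E : INR (2 ^ m) * rpow ((/ lam) ^ m) q = 1)
  by (rewrite <- Rmult_assoc, E; ring).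
rewrite pow_INR; change (INR 2) with 2; rewrite <- (rpow_two_pow_inv q m Hq).
fold lam; rewrite <- rpow_mult, <- Rpow_mult_distr, Rinv_r, pow1
  by (lra || apply pow_le; try apply Rlt_le, Rinv_0_lt_compat; lra).
apply rpow_1_l.
Qed.

(** Rises on [0, L], is 1 on [L, 2L], falls to 0 on [2L, 3L]. The plateau bounds the norm from
    below, the slope 1/L bounds the defect, and the zero ends leave no boundary term. *)
Definition trapezoid (L l : nat) : R :=
  Rmax 0 (Rmin 1 (Rmin (INR l / INR L) (3 - INR l / INR L))).

Lemma trapezoid_middle L l : (1 <= L)%nat -> (L <= l <= 2 * L)%nat -> trapezoid L l = 1.
Proof.
intros HL [H1 H2]; apply le_INR in H1, H2; rewrite mult_INR in H2; simpl (INR 2) in H2.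
assert (HL0 : 0 < INR L) by (apply lt_0_INR; lia).
assert (B1 : 1 <= INR l / INR L)
  by (apply Rmult_le_reg_r with (INR L); [lra|]; field_simplify; lra).
assert (B2 : INR l / INR L <= 2)
  by (apply Rmult_le_reg_r with (INR L); [lra|]; field_simplify; lra).
unfold trapezoid; rewrite (Rmin_left 1), Rmax_right; [reflexivity | lra |].
apply Rmin_glb; lra.
Qed.

Lemma trapezoid_end L l : (1 <= L)%nat -> (3 * L <= l)%nat -> trapezoid L l = 0.
Proof.
intros HL H; apply le_INR in H; rewrite mult_INR in H; simpl (INR 3) in H.
assert (HL0 : 0 < INR L) by (apply lt_0_INR; lia).
assert (B : 3 <= INR l / INR L)
  by (apply Rmult_le_reg_r with (INR L); [lra|]; field_simplify; lra).
unfold trapezoid; apply Rmax_left.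
apply Rle_trans with (1 := Rmin_r _ _), Rle_trans with (1 := Rmin_r _ _); lra.
Qed.

Lemma trapezoid_0 L : trapezoid L 0 = 0.
Proof.
unfold trapezoid; simpl (INR 0); unfold Rdiv; rewrite Rmult_0_l; apply Rmax_left.
apply Rle_trans with (1 := Rmin_r _ _), Rmin_l.
Qed.

Lemma trapezoid_step L l : (1 <= L)%nat ->
  Rabs (trapezoid L l - trapezoid L (S l)) <= / INR L.
Proof.
intros HL; assert (HL0 : 0 < / INR L) by (apply Rinv_0_lt_compat, lt_0_INR; lia).
unfold trapezoid; rewrite S_INR.
replace ((INR l + 1) / INR L) with (INR l / INR L + / INR L)
  by (field; apply not_0_INR; lia).
set (x := INR l / INR L); set (h := / INR L) in *; clearbody x h.
apply Rabs_le; unfold Rmax, Rmin; repeat destruct (Rle_dec _ _); lra.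
Qed.

Lemma lp_levels_bounds p L : Rbar_le (Finite 1) p -> (1 <= L)%nat ->
  exists A, 0 < A /\
    lp_list p (levels (fun l => (/ two_pow_inv p) ^ l * 1) (3 * L + 1)) <= 4 * A /\
    A <= lp_list p (levels (fun l => (/ two_pow_inv p) ^ l * trapezoid L l) (3 * L + 1)).
Proof.
intros Hp HL; destruct p as [q| |]; [| |contradiction].
- simpl in Hp; assert (HL0 : 1 <= INR L) by (apply (le_INR 1), HL).
  assert (Hiq : 0 <= 1 / q) by (apply Rlt_le, Rdiv_lt_0_compat; lra).
  (* The plateau has at least L generations and the whole tree 3L+1 <= 4L, with (4L)^(1/q) <= 4
     L^(1/q). *)
  exists (rpow (INR L) (1 / q)); cbn [lp_list].
  rewrite !powsum_levels by exact Hp; split; [|split].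
  + rewrite rpow_pos_eq by lra; apply Rpower_pos.
  + assert (E : forall m, fsum m (fun _ => rpow (Rabs 1) q) = INR m).
    { induction m as [|m IH]; [reflexivity|].
      rewrite S_INR; simpl; rewrite IH, Rabs_R1, rpow_1_l; reflexivity. }
    rewrite E.
    apply Rle_trans with (rpow (4 * INR L) (1 / q)).
    * apply rpow_le; [exact Hiq|]; split; [apply pos_INR|].
      rewrite plus_INR, mult_INR; simpl; lra.
    * rewrite rpow_mult by lra; apply Rmult_le_compat_r; [apply rpow_nonneg|].
      apply rpow_root_le; lra.
  + apply rpow_le; [exact Hiq|]; split; [lra|].
    set (f := fun l => rpow (Rabs (trapezoid L l)) q).
    assert (H1 : forall k, (k <= L)%nat -> INR k <= fsum (L + k) f).
    { induction k as [|k IH]; intros Hk.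
      - assert (H0 : forall n, 0 <= fsum n f)
          by (induction n as [|n IH]; cbn [fsum]; [lra|];
              apply Rplus_le_le_0_compat; [exact IH | apply rpow_nonneg]).
        apply H0.
      - rewrite <- plus_n_Sm, S_INR; cbn [fsum]; unfold f at 2.
        rewrite trapezoid_middle, Rabs_R1, rpow_1_l by lia.
        specialize (IH ltac:(lia)); lra. }
    assert (H2 : forall n k, fsum n f <= fsum (n + k) f).
    { intros n k; induction k as [|k IH]; [rewrite Nat.add_0_r; lra|].
      rewrite <- plus_n_Sm; cbn [fsum].
      rewrite <- (Rplus_0_r (fsum n f)).
      apply Rplus_le_compat; [exact IH | apply rpow_nonneg]. }
    apply Rle_trans with (1 := H1 L (Nat.le_refl L)).
    replace (3 * L + 1)%nat with (L + L + (L + 1))%nat by lia; apply H2.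
- exists 1; cbn [lp_list two_pow_inv]; split; [lra|]; split.
  + apply maxabs_le; [lra|]; intros x Hx.
    apply levels_In in Hx; destruct Hx as [l [_ ->]].
    rewrite Rinv_1, pow1, Rmult_1_r, Rabs_R1; lra.
  + rewrite <- Rabs_R1 at 1; apply maxabs_In, levels_In.
    exists L; split; [lia|]; rewrite trapezoid_middle, Rinv_1, pow1 by lia; ring.
Qed.

Lemma Dop_seq_scal c x : Dop (seq_scal c x) = seq_scal c (Dop x).
Proof.
apply functional_extensionality; intros [|j]; unfold seq_scal; simpl; [ring | reflexivity].
Qed.

Lemma approx_eigenvalue_of_quotients lam K :
  (forall L, (1 <= L)%nat -> exists w, mem w /\ 0 < nrm w /\
     nrm (seq_sub (Dop w) (seq_scal lam w)) <= K / INR L * nrm w) ->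
  approx_eigenvalue mem nrm Dop lam.
Proof.
intros H.
destruct (choice (fun n w => mem w /\ 0 < nrm w /\
     nrm (seq_sub (Dop w) (seq_scal lam w)) <= K / INR (S n) * nrm w)) as [w Hw].
{ intros n; apply H; lia. }
exists (fun n => seq_scal (/ nrm (w n)) (w n)); split.
- intros n; destruct (Hw n) as [H1 [H2 _]]; split; [apply mem_scal, H1|].
  rewrite nrm_scal, Rabs_right by (auto; apply Rle_ge, Rlt_le, Rinv_0_lt_compat, H2).
  field; lra.
- intros eps Heps; destruct (INR_unbounded (Rabs K / eps)) as [N HN].
  exists N; intros n Hn; destruct (Hw n) as [H1 [H2 H3]].
  assert (Hi : 0 < / nrm (w n)) by (apply Rinv_0_lt_compat, H2).
  replace (seq_sub _ _) with
    (seq_scal (/ nrm (w n)) (seq_sub (Dop (w n)) (seq_scal lam (w n)))).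
  2: { rewrite Dop_seq_scal; apply functional_extensionality; intros j.
    unfold seq_sub, seq_scal; ring. }
  rewrite nrm_scal, Rabs_right by (auto using mem_sub, mem_Dop, mem_scal; lra).
  assert (HS : INR N < INR (S n)) by (apply lt_INR; lia).
  assert (HS0 : 0 < INR (S n)) by (apply lt_0_INR; lia).
  apply Rle_lt_trans with (K / INR (S n)).
  + apply Rmult_le_reg_l with (nrm (w n)); [exact H2|].
    rewrite <- Rmult_assoc, Rinv_r, Rmult_1_l by lra; lra.
  + apply Rmult_lt_reg_r with (INR (S n)); [exact HS0|].
    unfold Rdiv; rewrite Rmult_assoc, Rinv_l, Rmult_1_r by lra.
    assert (HK : Rabs K < INR (S n) * eps).
    { replace (Rabs K) with (Rabs K / eps * eps) by (field; lra).
      apply Rmult_lt_compat_r; lra. }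
    generalize (Rle_abs K); lra.
Qed.

Lemma approx_eigenvalue_of_lp_copies p : Rbar_le (Finite 1) p ->
  lp_copies p -> approx_eigenvalue mem nrm Dop (two_pow_inv p).
Proof.
intros Hp [C [HC Hcop]].
destruct (two_pow_inv_bounds p Hp) as [Hlam1 Hlam2].
set (lam := two_pow_inv p) in *.
(* 8 C C collects lam <= 2, the factor 4 of [lp_levels_bounds], and one C from each of the two norm
   estimates. *)
apply (approx_eigenvalue_of_quotients lam (8 * C * C)); intros L HL.
assert (HL0 : 0 < INR L) by (apply lt_0_INR; lia).
(* One generation more than the trapezoid occupies, since the shifted weights reach one level
   further. *)
set (m := (3 * L + 1)%nat).
destruct (Hcop (2 ^ m)%nat) as [u [r [[Hu Hest] Hr]]].
assert (Hfin : forall i, (2 ^ r <= i)%nat -> u i = 0).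
{ intros i Hi; apply Hr; generalize (Nat.pow_gt_lin_r 2 r ltac:(lia)); lia. }
set (c := fun l => (/ lam) ^ l * trapezoid L l).
set (d := fun l => shift c l - lam * c l).
assert (Hc : forall l, (m <= l)%nat -> c l = 0).
{ intros l Hl; unfold c; rewrite trapezoid_end by lia; ring. }
assert (Hd : forall l, (m <= l)%nat -> d l = 0).
{ intros [|l] Hl; [lia|]; unfold d, c; simpl shift.
  rewrite !trapezoid_end by lia; ring. }
destruct (tree_copies r u c m Hu Hfin Hc) as [Hw Hwn].
destruct (tree_copies r u d m Hu Hfin Hd) as [_ Hdn].
assert (Hlen : forall f, (length (levels f m) <= 2 ^ m)%nat)
  by (intros f; generalize (length_levels f m); lia).
destruct (lp_levels_bounds p L Hp HL) as [A [HA [Hup Hlow]]]; fold lam m in Hup, Hlow.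
fold c in Hlow.
assert (HiC : 0 < / C) by (apply Rinv_0_lt_compat, HC).
assert (Hwlow : / C * A <= nrm (tree r u c)).
{ rewrite Hwn; apply Rle_trans with (2 := proj1 (Hest _ (Hlen c))).
  apply Rmult_le_compat_l; lra. }
exists (tree r u c); split; [exact Hw|]; split.
{ generalize (Rmult_lt_0_compat _ _ HiC HA); lra. }
replace (seq_sub (Dop (tree r u c)) (seq_scal lam (tree r u c))) with (tree r u d).
2: { rewrite Dop_tree; apply functional_extensionality; intros j.
  unfold seq_sub, seq_scal, tree, d.
  destruct (Nat.ltb (S j) (2 ^ r)); [ring|]; cbv zeta; ring. }
rewrite Hdn.
apply Rle_trans with (lam / INR L *
  copies_nrm u (levels (fun l => (/ lam) ^ l * 1) m)).
(* For l >= 1 the geometric factors match, and d l = lam^(1-l) (trapezoid (l-1) - trapezoid l). *)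
- assert (Hdl : forall l, Rabs (d l) <= lam / INR L * ((/ lam) ^ l * 1)).
  { intros [|l]; unfold d, c; simpl shift; simpl pow.
    - rewrite trapezoid_0; replace (0 - _) with 0 by ring; rewrite Rabs_R0.
      rewrite !Rmult_1_r; apply Rlt_le, Rdiv_lt_0_compat; lra.
    - assert (Hil : 0 <= (/ lam) ^ l)
        by (apply pow_le, Rlt_le, Rinv_0_lt_compat; lra).
      replace (_ - _) with ((/ lam) ^ l * (trapezoid L l - trapezoid L (S l)))
        by (field; lra).
      rewrite Rabs_mult, (Rabs_right ((/ lam) ^ l)) by lra.
      replace (lam / INR L * (/ lam * (/ lam) ^ l * 1)) with ((/ lam) ^ l * / INR L)
        by (field; lra).
      apply Rmult_le_compat_l; [exact Hil | apply trapezoid_step, HL]. }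
  assert (HlL : 0 <= lam / INR L) by (apply Rlt_le, Rdiv_lt_0_compat; lra).
  rewrite <- (Rabs_right (lam / INR L)) by lra.
  rewrite <- copies_nrm_scal by exact Hu.
  apply copies_nrm_le; [exact Hu|]; intros k.
  replace 0 with (lam / INR L * 0) at 2 by ring; rewrite map_nth.
  destruct (Nat.lt_ge_cases (S k) (2 ^ m)) as [Hk|Hk].
  + rewrite !nth_levels by exact Hk.
    apply Rle_trans with (1 := Hdl _), Rle_abs.
  + rewrite nth_overflow by (generalize (length_levels d m); lia).
    rewrite Rabs_R0; apply Rabs_pos.
- apply Rle_trans with (lam / INR L * (C * (4 * A))).
  + apply Rmult_le_compat_l; [apply Rlt_le, Rdiv_lt_0_compat; lra|].
    apply Rle_trans with (1 := proj2 (Hest _ (Hlen _))).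
    apply Rmult_le_compat_l; lra.
  + apply Rle_trans with (8 * C * C / INR L * (/ C * A)).
    * replace (8 * C * C / INR L * (/ C * A)) with (2 / INR L * (C * (4 * A)))
        by (field; lra).
      apply Rmult_le_compat_r; [apply Rmult_le_pos; lra|].
      apply Rmult_le_compat_r; [apply Rlt_le, Rinv_0_lt_compat, HL0 | lra].
    * apply Rmult_le_compat_l; [|exact Hwlow].
      apply Rlt_le, Rdiv_lt_0_compat; [|exact HL0].
      apply Rmult_lt_0_compat; [lra | exact HC].
Qed.

(** * Norms of equal copies of an approximate eigenvector *)

Section Doubling.

Context (u : seqR) (lam : R) (Hu : mem u) (Hlam : 1 <= lam <= 2).

Let defect := nrm (seq_sub (Dop u) (seq_scal lam u)).

Lemma defect_nonneg : 0 <= defect.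
Proof. apply nrm_nonneg; auto using mem_sub, mem_Dop, mem_scal. Qed.

(** Each half of the 2^(r+1) unit copies is traded for one copy weighted lam^r, the rest being a
    spectator in [l]; then the two merge. The errors satisfy E(r+1) <= 2 E(r) + lam^r defect, and
    lam <= 2 keeps them below 4^r defect. *)
Lemma pow_trade r l :
  Rabs (copies_nrm u (repeat 1 (2 ^ r) ++ l) - copies_nrm u (lam ^ r :: l))
    <= 4 ^ r * defect.
Proof.
assert (Hd := defect_nonneg).
revert l; induction r as [|r IH]; intros l.
{ simpl; rewrite Rminus_diag, Rabs_R0; lra. }
assert (H1 := copies_nrm_split u lam (lam ^ r) l Hu); fold defect in H1.
assert (H2 := IH (lam ^ r :: l)).
assert (H3 := IH (repeat 1 (2 ^ r) ++ l)).
rewrite (copies_nrm_perm u (lam ^ r :: repeat 1 (2 ^ r) ++ l)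
  (repeat 1 (2 ^ r) ++ lam ^ r :: l) Hu) in H3 by apply Permutation_middle.
replace (repeat 1 (2 ^ S r) ++ l) with (repeat 1 (2 ^ r) ++ repeat 1 (2 ^ r) ++ l)
  by (rewrite app_assoc, <- repeat_app; do 2 f_equal; simpl; lia).
assert (Hp : 0 <= lam ^ r <= 4 ^ r)
  by (split; [apply pow_le; lra | apply pow_incr; lra]).
rewrite (Rabs_right (lam ^ r)) in H1 by lra.
assert (H4 : lam ^ r * defect <= 4 ^ r * defect) by (apply Rmult_le_compat_r; lra).
assert (H5 : 0 <= 4 ^ r * defect) by (apply Rmult_le_pos; lra).
simpl pow; apply Rabs_le; apply Rabs_le_between in H1, H2, H3; lra.
Qed.

Lemma pow_bracket c J : 1 <= c <= lam ^ J ->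
  exists m, (m <= J)%nat /\ lam ^ m <= c <= lam ^ S m.
Proof.
induction J as [|J IH]; intros Hc.
- exists O; simpl in *; split; [auto | lra].
- destruct (Rle_dec c (lam ^ J)) as [H|H].
  + destruct IH as [m [Hm1 Hm2]]; [lra|]; exists m; auto.
  + exists J; split; [auto | lra].
Qed.

Context (q : R) (Hq : 1 <= q) (Hlamq : forall r, rpow (lam ^ r) q = 2 ^ r).

(** If lam^m <= c <= lam^(m+1), rounding up gives 2^(m+1) <= 2 c^q unit copies and rounding down
    gives 2^m >= c^q / 2. A weight c < 1 becomes one copy or none, which accounts for the terms 1
    and -1. *)
Lemma copies_nrm_cons_round c J : 0 <= c <= lam ^ J ->
  (exists N, INR N <= 1 + 2 * rpow c q /\ forall l,
     copies_nrm u (c :: l) <= copies_nrm u (repeat 1 N ++ l) + 4 ^ S J * defect) /\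
  (exists N, (rpow c q - 1) / 2 <= INR N /\ forall l,
     copies_nrm u (repeat 1 N ++ l) <= copies_nrm u (c :: l) + 4 ^ S J * defect).
Proof.
intros Hc.
assert (Hd := defect_nonneg).
assert (Hmono : forall x y l, 0 <= x <= y -> copies_nrm u (x :: l) <= copies_nrm u (y :: l)).
{ intros x y l Hxy; apply copies_nrm_le; [exact Hu|]; intros [|k]; simpl; [|lra].
  rewrite !Rabs_right; lra. }
assert (Herr : forall m, (m <= S J)%nat -> 4 ^ m * defect <= 4 ^ S J * defect).
{ intros m Hm; apply Rmult_le_compat_r; [exact Hd | apply Rle_pow; [lra | exact Hm]]. }
assert (H0 : 0 <= 4 ^ S J * defect) by (apply Rmult_le_pos; [apply pow_le|]; lra).
destruct (Rle_dec 1 c) as [H1|H1].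
- destruct (pow_bracket c J) as [m [Hm [Hlow Hup]]]; [lra|].
  assert (Hlm : 0 <= lam ^ m) by (apply pow_le; lra).
  split.
  + exists (2 ^ S m)%nat; split.
    * rewrite pow_INR; change (INR 2) with 2; simpl pow; rewrite <- (Hlamq m).
      assert (H := rpow_le (lam ^ m) c q ltac:(lra) ltac:(lra)); lra.
    * intros l; assert (H := pow_trade (S m) l); apply Rabs_le_between in H.
      generalize (Herr (S m) ltac:(lia)) (Hmono c (lam ^ S m) l ltac:(lra)); lra.
  + exists (2 ^ m)%nat; split.
    * rewrite pow_INR; change (INR 2) with 2.
      assert (H := rpow_le c (lam ^ S m) q ltac:(lra) ltac:(lra)).
      rewrite Hlamq in H; simpl pow in H; lra.
    * intros l; assert (H := pow_trade m l); apply Rabs_le_between in H.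
      generalize (Herr m ltac:(lia)) (Hmono (lam ^ m) c l ltac:(lra)); lra.
- assert (Hcq : 0 <= rpow c q <= 1).
  { split; [apply rpow_nonneg|]; rewrite <- (rpow_1_l q); apply rpow_le; lra. }
  split.
  + exists 1%nat; split; [simpl; lra|]; intros l.
    generalize (Hmono c 1 l ltac:(lra)); simpl repeat; simpl app; lra.
  + exists O; split; [simpl; lra|]; intros l.
    generalize (copies_nrm_app_r u (c :: nil) l Hu); simpl repeat; simpl app; lra.
Qed.

Lemma copies_nrm_round J b : (forall x, In x b -> 0 <= x <= lam ^ J) ->
  (exists N, INR N <= INR (length b) + 2 * powsum q b /\ forall l,
     copies_nrm u (b ++ l) <=
     copies_nrm u (repeat 1 N ++ l) + INR (length b) * (4 ^ S J * defect)) /\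
  (exists N, (powsum q b - INR (length b)) / 2 <= INR N /\ forall l,
     copies_nrm u (repeat 1 N ++ l) <=
     copies_nrm u (b ++ l) + INR (length b) * (4 ^ S J * defect)).
Proof.
induction b as [|x b IH]; intros Hb.
{ split; exists O; (split; [simpl; lra|]); intros l; simpl; lra. }
destruct IH as [[N1 [HN1 H1]] [N2 [HN2 H2]]]; [intros y Hy; apply Hb; right; exact Hy|].
destruct (copies_nrm_cons_round x J (Hb x (or_introl eq_refl)))
  as [[N3 [HN3 H3]] [N4 [HN4 H4]]].
assert (Hx : 0 <= x) by apply (Hb x (or_introl eq_refl)).
assert (Hperm : forall N l, copies_nrm u (repeat 1 N ++ b ++ l) =
  copies_nrm u (b ++ repeat 1 N ++ l)).
{ intros N l; apply copies_nrm_perm; [exact Hu | apply Permutation_app_swap_app]. }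
change (length (x :: b)) with (S (length b)); rewrite S_INR.
change (powsum q (x :: b)) with (rpow (Rabs x) q + powsum q b).
rewrite (Rabs_right x) by lra.
split.
- exists (N1 + N3)%nat; split; [rewrite plus_INR; lra|]; intros l.
  rewrite repeat_app, <- app_assoc.
  generalize (H3 (b ++ l)) (H1 (repeat 1 N3 ++ l)); rewrite Hperm; simpl app; lra.
- exists (N2 + N4)%nat; split; [rewrite plus_INR; lra|]; intros l.
  rewrite repeat_app, <- app_assoc.
  generalize (H4 (b ++ l)) (H2 (repeat 1 N4 ++ l)); rewrite Hperm; simpl app; lra.
Qed.

Lemma copies_nrm_repeat_mono n m : (n <= m)%nat ->
  copies_nrm u (repeat 1 n) <= copies_nrm u (repeat 1 m).
Proof.
intros H; replace m with (n + (m - n))%nat by lia; rewrite repeat_app.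
apply copies_nrm_app_l, Hu.
Qed.

Lemma copies_nrm_pow2 r : nrm u = 1 ->
  Rabs (copies_nrm u (repeat 1 (2 ^ r)) - lam ^ r) <= 4 ^ r * defect.
Proof.
intros H1; assert (H := pow_trade r nil); rewrite app_nil_r in H.
rewrite copies_nrm_single, H1, Rmult_1_r in H by exact Hu.
rewrite (Rabs_right (lam ^ r)) in H by (apply Rle_ge, pow_le; lra); exact H.
Qed.

Lemma lp_copies_estimate_of_defect M : nrm u = 1 ->
  INR (S M) * (4 ^ (M + 4) * defect) <= 1 / 8 ->
  lp_copies_estimate (Finite q) 8 M u.
Proof.
intros Hu1 Hsmall; split; [exact Hu|]; intros l Hl.
assert (Hd := defect_nonneg).
(* Rescaling l to norm lam^J makes its power sum 2^J = 4 * 2^M, which outweighs the loss of at most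
   M <= 2^M on small entries. Then N1 <= 9 * 2^M <= 2^(M+4) and N2 >= 2^M, while lam^2 <= 4 puts
   lam^M and lam^(M+4) within a factor 4 of lam^J. *)
set (J := (M + 2)%nat).
set (s := lp_list (Finite q) l).
assert (Hs : 0 <= s) by apply lp_list_nonneg.
destruct (Req_dec s 0) as [Hs0|Hs0].
{ rewrite Hs0, <- (map_scal_0 l), copies_nrm_scal, Rabs_R0; [lra | exact Hu |].
  intros x Hx; assert (H := lp_list_In (Finite q) l x Hq Hx); fold s in H.
  apply Rabs_eq_0; generalize (Rabs_pos x); lra. }
assert (HlamJ : 1 <= lam ^ J) by (apply pow_R1_Rle; lra).
set (t := lam ^ J / s).
assert (Ht : 0 < t) by (apply Rdiv_lt_0_compat; lra).
set (b := map Rabs (map (Rmult t) l)).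
assert (HFb : copies_nrm u b = t * copies_nrm u l).
{ rewrite <- (Rabs_right t), <- copies_nrm_scal by (exact Hu || lra).
  assert (HE : forall k, Rabs (nth k b 0) = Rabs (nth k (map (Rmult t) l) 0)).
  { intros k; unfold b; rewrite <- Rabs_R0 at 1; rewrite map_nth; apply Rabs_Rabsolu. }
  apply Rle_antisym; apply copies_nrm_le; auto; intros k; rewrite HE; lra. }
assert (Hlb : (length b <= M)%nat) by (unfold b; rewrite !length_map; exact Hl).
assert (Hin : forall x, In x b -> 0 <= x <= lam ^ J).
{ intros x Hx; unfold b in Hx; apply in_map_iff in Hx; destruct Hx as [y [<- Hy]].
  split; [apply Rabs_pos|].
  apply Rle_trans with (1 := lp_list_In (Finite q) _ y Hq Hy).
  rewrite lp_list_scal, Rabs_right by (exact Hq || lra); fold s.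
  right; unfold t; field; lra. }
assert (Hpb : powsum q b = 2 ^ J).
{ assert (E : powsum q b = powsum q (map (Rmult t) l)).
  { unfold b; generalize (map (Rmult t) l); intros l0.
    induction l0 as [|x l0 IH]; simpl; [reflexivity|].
    rewrite IH, Rabs_Rabsolu; reflexivity. }
  rewrite E, <- (rpow_rpow (powsum q _) (1 / q) q) by (apply powsum_nonneg || (field; lra)).
  change (rpow (powsum q (map (Rmult t) l)) (1 / q))
    with (lp_list (Finite q) (map (Rmult t) l)).
  rewrite lp_list_scal, Rabs_right by (exact Hq || lra); fold s.
  replace (t * s) with (lam ^ J) by (unfold t; field; lra); apply Hlamq. }
destruct (copies_nrm_round J b Hin) as [[N1 [HN1 H1]] [N2 [HN2 H2]]].
specialize (H1 nil); specialize (H2 nil); rewrite !app_nil_r, HFb in H1, H2.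
rewrite Hpb in HN1, HN2.
assert (HlbR : INR (length b) <= INR M) by (apply le_INR, Hlb).
assert (HM2 : INR M <= 2 ^ M).
{ change 2 with (INR 2) at 1; rewrite <- pow_INR.
  apply le_INR; generalize (Nat.pow_gt_lin_r 2 M ltac:(lia)); lia. }
assert (H2M : forall k, 2 ^ (M + k) = 2 ^ M * 2 ^ k) by (intros; apply pow_add).
unfold J in HN1, HN2; rewrite H2M in HN1, HN2.
assert (HN1' : (N1 <= 2 ^ (M + 4))%nat).
{ apply INR_le; rewrite pow_INR; change (INR 2) with 2; rewrite H2M; simpl; simpl in HN1.
  generalize (pow_lt 2 M ltac:(lra)); lra. }
assert (HN2' : (2 ^ M <= N2)%nat).
{ apply INR_le; rewrite pow_INR; change (INR 2) with 2; simpl in HN2.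
  generalize (pow_lt 2 M ltac:(lra)); lra. }
assert (H3 := copies_nrm_pow2 (M + 4) Hu1); apply Rabs_le_between in H3.
assert (H4 := copies_nrm_pow2 M Hu1); apply Rabs_le_between in H4.
assert (H5 := copies_nrm_repeat_mono _ _ HN1').
assert (H6 := copies_nrm_repeat_mono _ _ HN2').
set (err := 4 ^ (M + 4) * defect) in *.
assert (Herr : forall k, (k <= M + 4)%nat -> 0 <= 4 ^ k * defect <= err).
{ intros k Hk; split; [apply Rmult_le_pos; [apply pow_le|]; lra|].
  apply Rmult_le_compat_r; [exact Hd | apply Rle_pow; [lra | exact Hk]]. }
(* M errors come from rounding and one from [copies_nrm_pow2]: together at most 1/8, hence at most
   lam^J / 8. *)
assert (HSJ : INR (length b) * (4 ^ S J * defect) <= INR M * err).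
{ apply Rmult_le_compat; [apply pos_INR | apply Herr; unfold J; lia | exact HlbR |].
  apply Herr; unfold J; lia. }
rewrite S_INR in Hsmall.
assert (HlJ : lam ^ J = lam ^ M * (lam * lam))
  by (unfold J; rewrite pow_add; simpl; ring).
assert (HlJ4 : lam ^ (M + 4) = lam ^ J * (lam * lam))
  by (rewrite HlJ, pow_add; simpl; ring).
assert (Hll : 1 <= lam * lam <= 4) by (split; nra).
assert (HlM : 1 <= lam ^ M) by (apply pow_R1_Rle; lra).
assert (Hup : lam ^ (M + 4) <= 4 * lam ^ J) by (rewrite HlJ4; nra).
assert (Hlow : lam ^ J <= 4 * lam ^ M) by (rewrite HlJ; nra).
assert (HeM := Herr M ltac:(lia)).
assert (HtF : copies_nrm u l = s / lam ^ J * (t * copies_nrm u l))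
  by (unfold t; field; lra).
assert (Hr : 0 <= s / lam ^ J) by (apply Rmult_le_pos; [lra | apply Rlt_le, Rinv_0_lt_compat; lra]).
rewrite HtF; split.
- replace (/ 8 * s) with (s / lam ^ J * (lam ^ J / 8)) by (field; lra).
  apply Rmult_le_compat_l; [exact Hr|]; lra.
- replace (8 * s) with (s / lam ^ J * (8 * lam ^ J)) by (field; lra).
  apply Rmult_le_compat_l; [exact Hr|]; lra.
Qed.

End Doubling.

(** With eigenvalue 1, even 2^M unit copies have norm at most 2, and they dominate any list of M
    weights of modulus at most 1; one copy of a largest weight gives the lower bound. *)
Lemma lp_copies_estimate_infty u M : mem u -> nrm u = 1 ->
  4 ^ M * nrm (seq_sub (Dop u) (seq_scal 1 u)) <= 1 ->
  lp_copies_estimate p_infty 2 M u.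
Proof.
intros Hu Hu1 Hsmall; split; [exact Hu|]; intros l Hl; cbn [lp_list].
assert (Hm := maxabs_nonneg l); split.
- destruct l as [|y l0]; [simpl; generalize (copies_nrm_nonneg u nil Hu); lra|].
  destruct (maxabs_attained (y :: l0)) as [x [Hx Hxm]]; [discriminate|].
  apply Rle_trans with (maxabs (y :: l0)); [lra|]; rewrite <- Hxm.
  apply in_split in Hx; destruct Hx as [l1 [l2 ->]].
  rewrite <- (Rmult_1_r (Rabs x)), <- Hu1, <- copies_nrm_single by exact Hu.
  eapply Rle_trans; [|apply copies_nrm_app_r, Hu].
  apply (copies_nrm_app_l u (x :: nil) l2 Hu).
- assert (H := copies_nrm_pow2 u 1 Hu ltac:(lra) M Hu1).
  rewrite pow1 in H; apply Rabs_le_between in H.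
  apply Rle_trans with (maxabs l * copies_nrm u (repeat 1 (2 ^ M))).
  + rewrite <- (Rabs_right (maxabs l)), <- copies_nrm_scal by (exact Hu || lra).
    apply copies_nrm_le; [exact Hu|]; intros k.
    rewrite map_repeat, Rmult_1_r.
    assert (HM := Nat.pow_gt_lin_r 2 M ltac:(lia)).
    destruct (Nat.lt_ge_cases k (length l)) as [Hk|Hk].
    * rewrite (nth_repeat_lt _ 0), (Rabs_right (maxabs l)) by (lia || lra).
      apply maxabs_In, nth_In, Hk.
    * rewrite nth_overflow by exact Hk; rewrite Rabs_R0; apply Rabs_pos.
  + rewrite (Rmult_comm 2); apply Rmult_le_compat_l; lra.
Qed.

Lemma lp_copies_of_approx_eigenvalue p : separable mem nrm -> Rbar_le (Finite 1) p ->
  approx_eigenvalue mem nrm Dop (two_pow_inv p) -> lp_copies p.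
Proof.
intros Hsep Hp [u [Hu Hlim]].
assert (Hex : forall e, 0 < e -> exists v, mem v /\ nrm v = 1 /\
  nrm (seq_sub (Dop v) (seq_scal (two_pow_inv p) v)) <= e).
{ intros e He; destruct (Hlim e He) as [N HN].
  exists (u N); destruct (Hu N); repeat split; auto.
  apply Rlt_le, HN, Nat.le_refl. }
apply (lp_copies_truncate p 8 Hsep Hp ltac:(lra)); intros M.
assert (HM : 0 < INR (S M)) by (apply lt_0_INR; lia).
assert (H4 : forall k, 0 < 4 ^ k) by (intros k; apply pow_lt; lra).
(* Small enough for both cases: finite p needs (M+1) 4^(M+4) defect <= 1/8, and p = oo needs 4^M
   defect <= 1. *)
destruct (Hex (/ (8 * INR (S M) * 4 ^ (M + 4)))) as [v [Hv [Hv1 Hd]]].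
{ apply Rinv_0_lt_compat, Rmult_lt_0_compat; [lra | apply H4]. }
set (d := nrm (seq_sub (Dop v) (seq_scal (two_pow_inv p) v))) in *.
exists v.
assert (Hsmall : INR (S M) * (4 ^ (M + 4) * d) <= 1 / 8).
{ apply Rle_trans with
    (INR (S M) * (4 ^ (M + 4) * / (8 * INR (S M) * 4 ^ (M + 4)))).
  - do 2 (apply Rmult_le_compat_l; [generalize (H4 (M + 4)%nat); lra|]); exact Hd.
  - right; generalize (H4 (M + 4)%nat); intros; field; lra. }
assert (Hb := two_pow_inv_bounds p Hp).
destruct p as [q| |]; [| |contradiction].
- apply (lp_copies_estimate_of_defect v (two_pow_inv (Finite q))); auto.
  intros r; apply rpow_two_pow_inv, Hp.
- destruct (lp_copies_estimate_infty v M Hv Hv1) as [H0 H1].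
  { change (4 ^ M * d <= 1).
    assert (Hd0 : 0 <= d) by (apply nrm_nonneg; auto using mem_sub, mem_Dop, mem_scal).
    apply Rle_trans with (INR (S M) * (4 ^ (M + 4) * d)); [|lra].
    rewrite <- (Rmult_1_l (4 ^ M * d)).
    apply Rmult_le_compat; [lra | apply Rmult_le_pos; [apply Rlt_le, H4 | exact Hd0] | |].
    - apply (le_INR 1); lia.
    - apply Rmult_le_compat_r; [exact Hd0 | apply Rle_pow; [lra | lia]]. }
  split; [exact H0|]; intros l Hl; destruct (H1 l Hl) as [H2 H3].
  generalize (lp_list_nonneg p_infty l); split; lra.
Qed.

End SymmetricSpace.

Theorem theorem3p1 (mem : seqR -> Prop) (nrm : seqR -> R) (p : Rbar) :
  symmetric_seq_space mem nrm -> separable mem nrm ->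
  Rbar_le (Finite 1) p ->
  (sym_block_fin_rep mem nrm p <-> sym_fin_rep mem nrm p) /\
  (sym_fin_rep mem nrm p <-> crude_sym_fin_rep mem nrm p) /\
  (crude_sym_fin_rep mem nrm p <-> approx_eigenvalue mem nrm Dop (two_pow_inv p)).
Proof.
intros HX Hsep Hp.
assert (Hab := @sym_fin_rep_of_block mem nrm p).
assert (Hbc := @crude_of_sym_fin_rep mem nrm p).
assert (Hc := lp_copies_of_crude HX p Hsep Hp).
assert (Ha : lp_copies (mem := mem) (nrm := nrm) p -> sym_block_fin_rep mem nrm p).
{ intros H; apply (sym_block_fin_rep_of_sharp HX p Hp).
  destruct p as [q| |]; [| |contradiction].
  - apply (sharp_copies_finite HX q Hp H).
  - apply (sharp_copies_infty HX H). }
assert (Hd := approx_eigenvalue_of_lp_copies HX p Hp).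
assert (Hd' := lp_copies_of_approx_eigenvalue HX p Hsep Hp).
tauto.
Qed.
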